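(* Let $k$ be an algebraically closed field and $n$ a positive integer. Let $A_n$ be the path algebra over $k$ of the linear quiver $1 \leftarrow 2 \leftarrow \cdots \leftarrow n$, and let $B_n$ be the quotient of the path algebra over $k$ of the cyclic quiver with vertices $1,\dots,n$ and arrows $2 \to 1$, $3 \to 2$, $\dots$, $n \to n-1$, $1 \to n$ by the ideal generated by all paths of length $n$. Then $$\#\,\mathsf{mbrick}\,A_n = \sum_{i=0}^n \frac{1}{i+1}\binom{n}{i}\binom{n+i}{i},$$ which is the $n$-th large Schröder number, and $$\#\,\mathsf{mbrick}\,B_n = 2 \sum_{i=0}^{n-1} \binom{n-1}{i}\binom{n+i}{i}.$$
   Context: For a finite-dimensional algebra $\Lambda$, $\mathsf{mbrick}\,\Lambda$ denotes the set of monobricks in the category $\mathsf{mod}\,\Lambda$ of finitely generated right $\Lambda$-modules. A brick is a module whose endomorphism ring is a division ring. A monobrick is a set $\mathcal{M}$ of isomorphism classes of bricks such that every morphism between elements of $\mathcal{M}$ is either zero or injective. $\#X$ denotes the cardinality of a set $X$. For $n=1$ the cyclic quiver is one vertex with one loop, so $B_1 = k$. *)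

(* Defs.v *)
From HB Require Import structures.
From mathcomp Require Import all_boot all_order all_algebra finmap generic_quotient.
From mathcomp Require Import boolp monalg.

Set Implicit Arguments.
Unset Strict Implicit.
Unset Printing Implicit Defensive.

Import GRing.Theory.

Local Open Scope ring_scope.

Definition fin_gen (R : pzRingType) (M : lmodType R) : Prop :=
  exists s : seq M, forall x : M,
    exists c : 'I_(size s) -> R, x = \sum_(i < size s) c i *: s`_i.

(* A right L-module is a left module over the converse ring L^c. *)
Record fgmod (L : pzRingType) : Type := FgMod {
  fgmod_sort :> lmodType L^c;
  fgmodP : fin_gen fgmod_sort }.

(* End(M) is a division ring: it is nonzero (i.e. M is nonzero), and every
   nonzero endomorphism has a two-sided inverse. *)
Definition brick (L : pzRingType) (M : fgmod L) : Prop :=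
  (exists x : M, x <> 0) /\
  forall f : {linear M -> M}, (exists x, f x <> 0) ->
    exists g : {linear M -> M}, cancel f g /\ cancel g f.

Definition isomorphic (L : pzRingType) (M N : fgmod L) : Prop :=
  exists (f : {linear M -> N}) (g : {linear N -> M}), cancel f g /\ cancel g f.

(* Classes of modules are plain Prop-valued predicates: the universe
   constraints of MathComp-Analysis forbid [classical_sets.set (fgmod L)]. *)
Definition iso_class (L : pzRingType) (M : fgmod L) : fgmod L -> Prop :=
  isomorphic M.

Definition monobrick (L : pzRingType) (C : (fgmod L -> Prop) -> Prop) : Prop :=
  (forall c, C c -> exists2 M : fgmod L, brick M & c = iso_class M) /\
  (forall M N : fgmod L, C (iso_class M) -> C (iso_class N) ->
     forall f : {linear M -> N}, (forall x, f x = 0) \/ injective f).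

Definition has_card (T : Type) (P : T -> Prop) (m : nat) : Prop :=
  exists e : 'I_m -> T, injective e /\ forall x, P x <-> exists i, x = e i.

Record quiver : Type := Quiver {
  vertex : finType;
  arrow : finType;
  src : arrow -> vertex;
  tgt : arrow -> vertex }.

Fixpoint walk (Q : quiver) (v : vertex Q) (s : seq (arrow Q)) : bool :=
  if s is a :: s' then (src a == v) && walk (tgt a) s' else true.

Definition walk_end (Q : quiver) (v : vertex Q) (s : seq (arrow Q)) : vertex Q :=
  last v (map (@tgt Q) s).

(* A path is a starting vertex with a sequence of composable arrows, in the
   order in which they are traversed; it is trivial when the sequence is empty. *)
Definition qpath (Q : quiver) : Type :=
  {p : vertex Q * seq (arrow Q) | walk p.1 p.2}.

Section Paths.
Variable Q : quiver.
Implicit Types (p q r : qpath Q) (v : vertex Q).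

Definition path_src p : vertex Q := (val p).1.
Definition path_arrows p : seq (arrow Q) := (val p).2.
Definition path_tgt p : vertex Q := walk_end (path_src p) (path_arrows p).
Definition path_length p : nat := size (path_arrows p).

Definition trivial_path v : qpath Q :=
  exist (fun p : vertex Q * seq (arrow Q) => walk p.1 p.2) (v, [::]) isT.

(* [p] followed by [q]; meaningful when [path_tgt p = path_src q] (otherwise
   the default value of [insubd] may be returned). *)
Definition path_cat p q : qpath Q :=
  insubd p (path_src p, path_arrows p ++ path_arrows q).

Lemma walk_cat v s1 s2 :
  walk v (s1 ++ s2) = walk v s1 && walk (walk_end v s1) s2 :> bool.
Proof. by elim: s1 v => //= a s1 IH v; rewrite IH andbA. Qed.

Lemma path_catK p q : path_tgt p = path_src q ->
  val (path_cat p q) = (path_src p, path_arrows p ++ path_arrows q).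
Proof.
move=> pq; rewrite val_insubd /= walk_cat -[walk_end _ _]/(path_tgt p) pq.
by rewrite /path_src /path_arrows (valP p) (valP q).
Qed.

Lemma path_cat_src p q : path_tgt p = path_src q ->
  path_src (path_cat p q) = path_src p.
Proof. by move=> pq; rewrite /path_src path_catK. Qed.

Lemma path_cat_tgt p q : path_tgt p = path_src q ->
  path_tgt (path_cat p q) = path_tgt q.
Proof.
move=> pq; rewrite {1}/path_tgt {1}/path_src {1}/path_arrows path_catK //=.
rewrite /walk_end map_cat last_cat -[last _ (map _ (path_arrows p))]/(path_tgt p).
by rewrite pq.
Qed.

Lemma path_catA p q r : path_tgt p = path_src q -> path_tgt q = path_src r ->
  path_cat p (path_cat q r) = path_cat (path_cat p q) r.
Proof.
move=> pq qr; apply: val_inj.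
rewrite !path_catK ?path_cat_src ?path_cat_tgt //.
by rewrite /path_arrows !path_catK //= catA.
Qed.

End Paths.

Definition path_alg (k : fieldType) (Q : quiver) : Type := {malg k[qpath Q]}.

HB.instance Definition _ (k : fieldType) (Q : quiver) :=
  GRing.Lmodule.on (path_alg k Q).

HB.lock Definition path_vec (k : fieldType) (Q : quiver) (p : qpath Q) :
  path_alg k Q := << 1 *g p >>.

(* [p * q] is "first p, then q", or zero if they are not composable; so right
   modules are covariant representations: an arrow a : i -> j acts on a module
   M as M e_i -> M e_j. *)
HB.lock Definition path_mul (k : fieldType) (Q : quiver) (p q : qpath Q) :
    path_alg k Q :=
  if path_tgt p == path_src q then path_vec k (path_cat p q) else 0.

HB.lock Definition palg_mul (k : fieldType) (Q : quiver) (x y : path_alg k Q) :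
    path_alg k Q :=
  \sum_(p <- msupp x) \sum_(q <- msupp y) (x@_p * y@_q) *: path_mul k p q.

Arguments palg_mul {k Q}.

Section PathAlgebra.
Variables (k : fieldType) (Q : quiver).
Local Notation A := (path_alg k Q).
Implicit Types (p q r : qpath Q) (x y z : A).

Local Notation path_vec := (path_vec k).
Local Notation path_mul := (path_mul k).

Lemma path_mul_cat p q :
  path_tgt p = path_src q -> path_mul p q = path_vec (path_cat p q).
Proof. by rewrite path_mul.unlock => ->; rewrite eqxx. Qed.

Lemma path_mul0 p q : path_tgt p != path_src q -> path_mul p q = 0.
Proof. by rewrite path_mul.unlock => /negPf->. Qed.

Definition palg_one : A := \sum_(v : vertex Q) path_vec (trivial_path v).

Lemma palgE x : x = \sum_(p <- msupp x) x@_p *: path_vec p.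
Proof.
rewrite {1}[x]monalgE path_vec.unlock; apply: eq_bigr => p _; apply/malgP => q.
by rewrite [LHS]mcoeffU [RHS]mcoeffZ [X in _ = _ * X]mcoeffU mulr_natr.
Qed.

Lemma palg_mulw (d1 d2 : {fset qpath Q}) x y :
  (msupp x `<=` d1)%fset -> (msupp y `<=` d2)%fset ->
  palg_mul x y = \sum_(p <- d1) \sum_(q <- d2) (x@_p * y@_q) *: path_mul p q.
Proof.
move=> le_d1 le_d2; rewrite palg_mul.unlock (big_fset_incl _ le_d1) /=.
  apply/eq_bigr=> p _; apply/big_fset_incl => // q _ /mcoeff_outdom ->.
  by rewrite mulr0 scale0r.
move=> p _ /mcoeff_outdom xp0.
by rewrite big1 // => q _; rewrite xp0 mul0r scale0r.
Qed.

Lemma palg_mulDl : left_distributive (@palg_mul k Q) +%R.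
Proof.
move=> x y z.
rewrite (palg_mulw (msuppD_le x y) (fsubset_refl (msupp z))).
rewrite (palg_mulw (fsubsetUl (msupp x) (msupp y)) (fsubset_refl (msupp z))).
rewrite (palg_mulw (fsubsetUr (msupp x) (msupp y)) (fsubset_refl (msupp z))).
rewrite -big_split /=; apply/eq_bigr=> p _.
rewrite -big_split /=; apply/eq_bigr=> q _.
by rewrite mcoeffD mulrDl scalerDl.
Qed.

Lemma palg_mulDr : right_distributive (@palg_mul k Q) +%R.
Proof.
move=> z x y.
rewrite (palg_mulw (fsubset_refl (msupp z)) (msuppD_le x y)).
rewrite (palg_mulw (fsubset_refl (msupp z)) (fsubsetUl (msupp x) (msupp y))).
rewrite (palg_mulw (fsubset_refl (msupp z)) (fsubsetUr (msupp x) (msupp y))).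
rewrite -big_split /=; apply/eq_bigr=> p _.
rewrite -big_split /=; apply/eq_bigr=> q _.
by rewrite mcoeffD mulrDr scalerDl.
Qed.

Lemma palg_mul0l y : palg_mul 0 y = 0.
Proof. by rewrite palg_mul.unlock msupp0 big_seq_fset0. Qed.

Lemma palg_mul0r x : palg_mul x 0 = 0.
Proof.
by rewrite palg_mul.unlock msupp0 big1 // => p _; rewrite big_seq_fset0.
Qed.

Lemma palg_mulZl c x y : palg_mul (c *: x) y = c *: palg_mul x y.
Proof.
rewrite (palg_mulw (msuppZ_le c x) (fsubset_refl (msupp y))) palg_mul.unlock scaler_sumr.
apply/eq_bigr=> p _; rewrite scaler_sumr; apply/eq_bigr=> q _.
by rewrite mcoeffZ scalerA mulrA.
Qed.

Lemma palg_mulZr c x y : palg_mul x (c *: y) = c *: palg_mul x y.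
Proof.
rewrite (palg_mulw (fsubset_refl (msupp x)) (msuppZ_le c y)) palg_mul.unlock scaler_sumr.
apply/eq_bigr=> p _; rewrite scaler_sumr; apply/eq_bigr=> q _.
by rewrite mcoeffZ scalerA mulrCA.
Qed.

Lemma palg_mulUU p q : palg_mul (path_vec p) (path_vec q) = path_mul p q.
Proof.
rewrite (palg_mulw (d1 := [fset p]%fset) (d2 := [fset q]%fset)) ?path_vec.unlock ?msuppU_le //.
by rewrite !big_seq_fset1 !mcoeffUU mulr1 scale1r.
Qed.

Lemma palg_mul_suml (I : Type) (s : seq I) (P : pred I) (F : I -> A) y :
  palg_mul (\sum_(i <- s | P i) F i) y = \sum_(i <- s | P i) palg_mul (F i) y.
Proof.
by apply: (big_morph (palg_mul^~ y)) => [x z|]; rewrite ?palg_mulDl ?palg_mul0l.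
Qed.

Lemma palg_mul_sumr (I : Type) (s : seq I) (P : pred I) (F : I -> A) x :
  palg_mul x (\sum_(i <- s | P i) F i) = \sum_(i <- s | P i) palg_mul x (F i).
Proof.
by apply: (big_morph (palg_mul x)) => [y z|]; rewrite ?palg_mulDr ?palg_mul0r.
Qed.

Lemma path_mulA p q r :
  palg_mul (path_vec p) (path_mul q r) = palg_mul (path_mul p q) (path_vec r).
Proof.
have [qr|qr] := eqVneq (path_tgt q) (path_src r);
  have [pq|pq] := eqVneq (path_tgt p) (path_src q).
- rewrite (path_mul_cat qr) (path_mul_cat pq) [LHS]palg_mulUU [RHS]palg_mulUU.
  rewrite !path_mul_cat ?path_cat_src ?path_cat_tgt //.
  by rewrite path_catA.
- rewrite (path_mul_cat qr) (path_mul0 pq) palg_mul0l palg_mulUU path_mul0 //.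
  by rewrite path_cat_src.
- rewrite (path_mul0 qr) (path_mul_cat pq) palg_mul0r palg_mulUU path_mul0 //.
  by rewrite path_cat_tgt.
- by rewrite (path_mul0 qr) (path_mul0 pq) palg_mul0r palg_mul0l.
Qed.

Lemma palg_mulA : associative (@palg_mul k Q).
Proof.
move=> x y z; rewrite [x]palgE [y]palgE [z]palgE.
rewrite [LHS]palg_mul_suml [X in _ = palg_mul X _]palg_mul_suml.
rewrite [RHS]palg_mul_suml; apply: eq_bigr => p _.
rewrite [X in palg_mul _ X = _]palg_mul_suml [LHS]palg_mul_sumr.
rewrite [X in _ = palg_mul X _]palg_mul_sumr [RHS]palg_mul_suml.
apply: eq_bigr => q _.
rewrite [X in palg_mul _ X = _]palg_mul_sumr [LHS]palg_mul_sumr.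
rewrite [RHS]palg_mul_sumr; apply: eq_bigr => r _.
rewrite [LHS]palg_mulZl [X in _ *: palg_mul _ X]palg_mulZl.
rewrite [X in _ *: palg_mul _ (_ *: X)]palg_mulZr palg_mulUU.
rewrite [X in _ = palg_mul X _]palg_mulZl [X in _ = palg_mul (_ *: X) _]palg_mulZr.
rewrite [X in _ = palg_mul (_ *: (_ *: X)) _]palg_mulUU.
rewrite [RHS]palg_mulZl [X in _ = _ *: X]palg_mulZl.
rewrite [X in _ = _ *: (_ *: X)]palg_mulZr -path_mulA.
by rewrite [X in _ *: X = _]palg_mulZr [X in _ *: (_ *: X) = _]palg_mulZr.
Qed.

Lemma path_mul_trivl v p :
  path_mul (trivial_path v) p = if v == path_src p then path_vec p else 0.
Proof.
rewrite path_mul.unlock {1}/path_tgt /walk_end /=; case: eqP => // vp.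
congr path_vec; apply: val_inj; rewrite path_catK //=.
by move: vp; rewrite /path_src /path_arrows /= => ->; case: (val p).
Qed.

Lemma path_mul_trivr v p :
  path_mul p (trivial_path v) = if path_tgt p == v then path_vec p else 0.
Proof.
rewrite path_mul.unlock {1}/path_src /=; case: eqP => // vp.
congr path_vec; apply: val_inj; rewrite path_catK //=.
by rewrite /path_src /path_arrows cats0 -surjective_pairing.
Qed.

Lemma palg_one_path p : palg_mul palg_one (path_vec p) = path_vec p.
Proof.
rewrite /palg_one palg_mul_suml (bigD1 (path_src p)) //=.
rewrite palg_mulUU path_mul_trivl eqxx big1 ?addr0 // => v /negPf vp.
by rewrite palg_mulUU path_mul_trivl vp.
Qed.

Lemma palg_path_one p : palg_mul (path_vec p) palg_one = path_vec p.
Proof.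
rewrite /palg_one palg_mul_sumr (bigD1 (path_tgt p)) //=.
rewrite palg_mulUU path_mul_trivr eqxx big1 ?addr0 // => v /negPf vp.
by rewrite palg_mulUU path_mul_trivr eq_sym vp.
Qed.

Lemma palg_mul1l : left_id palg_one (@palg_mul k Q).
Proof.
move=> x; rewrite {1}[x]palgE [LHS]palg_mul_sumr [RHS]palgE.
by apply: eq_bigr => p _; rewrite [LHS]palg_mulZr palg_one_path.
Qed.

Lemma palg_mul1r : right_id palg_one (@palg_mul k Q).
Proof.
move=> x; rewrite {1}[x]palgE [LHS]palg_mul_suml [RHS]palgE.
by apply: eq_bigr => p _; rewrite [LHS]palg_mulZl palg_path_one.
Qed.

HB.instance Definition _ := GRing.Zmodule_isPzRing.Build A
  palg_mulA palg_mul1l palg_mul1r palg_mulDl palg_mulDr.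

Lemma palg_scalerAl (c : k) x y : c *: (x * y) = (c *: x) * y.
Proof. exact/esym/palg_mulZl. Qed.

Lemma palg_scalerAr (c : k) x y : c *: (x * y) = x * (c *: y).
Proof. exact/esym/palg_mulZr. Qed.

End PathAlgebra.

Definition two_sided_ideal (R : pzRingType) (I : R -> Prop) : Prop :=
  [/\ I 0, forall x y, I x -> I y -> I (x - y)
    & forall a x, I x -> I (a * x) /\ I (x * a)].

Definition in_ideal_gen (R : pzRingType) (S : R -> Prop) (x : R) : Prop :=
  forall I : R -> Prop, two_sided_ideal I -> (forall s, S s -> I s) -> I x.

Definition ideal_gen (R : pzRingType) (S : R -> Prop) : {pred R} :=
  fun x => `[< in_ideal_gen S x >].

Section IdealQuotient.
Variables (R : pzRingType) (S : R -> Prop).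

Lemma ideal_gen_zmod_closed : zmod_closed (ideal_gen S).
Proof.
split=> [|x y /asboolP Sx /asboolP Sy]; apply/asboolP => I idI SI;
  have [I0 IB _] := idI; first exact: I0.
by apply: IB; [apply: Sx|apply: Sy].
Qed.

HB.instance Definition _ :=
  GRing.isZmodClosed.Build R (ideal_gen S) ideal_gen_zmod_closed.

Lemma ideal_genMl a x : x \in ideal_gen S -> a * x \in ideal_gen S.
Proof.
move=> /asboolP Sx; apply/asboolP => I idI SI.
by have [_ _ IM] := idI; have [] := IM a x (Sx I idI SI).
Qed.

Lemma ideal_genMr a x : x \in ideal_gen S -> x * a \in ideal_gen S.
Proof.
move=> /asboolP Sx; apply/asboolP => I idI SI.
by have [_ _ IM] := idI; have [] := IM a x (Sx I idI SI).
Qed.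

End IdealQuotient.

Definition quot_ring (R : pzRingType) (S : R -> Prop) : Type :=
  Quotient.quot (ideal_gen S).

Section QuotientRing.
Local Open Scope quotient_scope.
Variables (R : pzRingType) (S : R -> Prop).
Local Notation Q := (quot_ring S).
Implicit Types (x y : R).

HB.instance Definition _ := GRing.Zmodule.on Q.
HB.instance Definition _ := EqQuotient.on Q.

Definition quot_one : Q := \pi_Q 1.
Definition quot_mul (x y : Q) : Q := \pi_Q (repr x * repr y).

Lemma quot_eqE x y : (\pi_Q x == \pi_Q y) = (x - y \in ideal_gen S).
Proof. by rewrite (Quotient.idealrBE (ideal_gen S)). Qed.

Lemma quot_repr x : repr (\pi_Q x) - x \in ideal_gen S.
Proof. by rewrite -quot_eqE reprK. Qed.

Lemma quot_piM x y : quot_mul (\pi_Q x) (\pi_Q y) = \pi_Q (x * y).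
Proof.
apply/eqP; rewrite quot_eqE.
have -> : repr (\pi_Q x) * repr (\pi_Q y) - x * y =
    (repr (\pi_Q x) - x) * repr (\pi_Q y) + x * (repr (\pi_Q y) - y).
  by rewrite mulrBl mulrBr addrA subrK.
by apply: rpredD; [apply/ideal_genMr/quot_repr | apply/ideal_genMl/quot_repr].
Qed.

Lemma quot_piD x y : \pi_Q (x + y) = \pi_Q x + \pi_Q y.
Proof. exact: (Quotient.pi_add (ideal_gen S) x y). Qed.

Lemma quot_mulA : associative quot_mul.
Proof.
move=> x y z; rewrite -[x]reprK -[y]reprK -[z]reprK.
move: (repr x) (repr y) (repr z) => {}x {}y {}z.
by rewrite (quot_piM y z) (quot_piM x y) (quot_piM x) (quot_piM (x * y)) mulrA.
Qed.

Lemma quot_mul1l : left_id quot_one quot_mul.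
Proof. by move=> x; rewrite -{1}[x]reprK [LHS]quot_piM mul1r reprK. Qed.

Lemma quot_mul1r : right_id quot_one quot_mul.
Proof. by move=> x; rewrite -{1}[x]reprK [LHS]quot_piM mulr1 reprK. Qed.

Lemma quot_mulDl : left_distributive quot_mul +%R.
Proof.
move=> x y z; rewrite -[x]reprK -[y]reprK -[z]reprK.
move: (repr x) (repr y) (repr z) => {}x {}y {}z.
rewrite -(quot_piD x y) (quot_piM (x + y)) (quot_piM x) (quot_piM y).
by rewrite mulrDl quot_piD.
Qed.

Lemma quot_mulDr : right_distributive quot_mul +%R.
Proof.
move=> x y z; rewrite -[x]reprK -[y]reprK -[z]reprK.
move: (repr x) (repr y) (repr z) => {}x {}y {}z.
rewrite -(quot_piD y z) (quot_piM x (y + z)) (quot_piM x y) (quot_piM x z).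
by rewrite mulrDr quot_piD.
Qed.

HB.instance Definition _ := GRing.Zmodule_isPzRing.Build Q
  quot_mulA quot_mul1l quot_mul1r quot_mulDl quot_mulDr.

End QuotientRing.

(* Vertices are shifted to 0, ..., n-1.  The arrow indexed by i > 0 goes
   from i to i - 1; [ord_pred] is the cyclic predecessor on ['I_n]. *)
Definition linear_quiver (n : nat) : quiver :=
  @Quiver 'I_n {i : 'I_n | (0 < i)%N} val (fun i => ord_pred (val i)).

Definition cyclic_quiver (n : nat) : quiver :=
  @Quiver 'I_n 'I_n id (@ord_pred n).

Definition A_alg (k : fieldType) (n : nat) : pzRingType :=
  path_alg k (linear_quiver n).

Definition path_of_length (k : fieldType) (Q : quiver) (m : nat)
    (x : path_alg k Q) : Prop :=
  exists2 p : qpath Q, path_length p = m & x = path_vec k p.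

Definition B_alg (k : fieldType) (n : nat) : pzRingType :=
  quot_ring (@path_of_length k (cyclic_quiver n) n).

(* Steps of a lattice path: [Some true] is (1, 0), [Some false] is (0, 1) and [None] is
   the diagonal step (1, 1). *)
Definition end_x (s : seq (option bool)) : nat := count (predC1 (Some false)) s.
Definition end_y (s : seq (option bool)) : nat := count (predC1 (Some true)) s.

Definition schroeder_path (n : nat) (s : seq (option bool)) : bool :=
  [&& end_x s == n, end_y s == n &
      all (fun i => end_y (take i s) <= end_x (take i s))%N (iota 0 (size s).+1)].

(* The number of lattice paths from (0, 0) to (n, n) that never rise above the
   diagonal; such a path has at most 2n steps. *)
Definition large_schroeder (n : nat) : nat :=
  #|[set s : {bseq n.*2 of option bool} | schroeder_path n s]|.

(* Main.v *)
(* A brick over [A_n] or [B_n] is uniserial and is determined by its top [i] and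
   its length [l], hence by the arc [i, i - 1, ..., i - l + 1] on the [n]-cycle;
   over [A_n] the arc must not wrap around. Indeed a longest path acting
   nontrivially on the brick generates a uniserial submodule that is a direct
   summand. A nonzero map between two such modules has the common part of the two
   arcs as its image, so a monobrick is a set of arcs in which every arc starting
   inside another one is contained in it.
   Splitting such a set along its largest arc through a given vertex leaves two
   independent sets on linear segments. For a segment of [m] vertices this is the
   recurrence S_(m+1) = S_m + sum_i S_i S_(m-i) of the large Schroeder numbers; for
   the cycle it gives S_(n-1) + sum_l (l+1) S_l S_(n-1-l), that is half of
   (n+1) S_n - (n-1) S_(n-1). *)
Require Import Defs.
From HB Require Import structures.
From mathcomp Require Import all_boot all_order all_algebra finmap generic_quotient.
From mathcomp Require Import boolp monalg.
From mathcomp Require Import ring zify.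

Set Implicit Arguments.
Unset Strict Implicit.
Unset Printing Implicit Defensive.

Import Order.TTheory GRing.Theory Num.Theory.

(** * Lattice paths below the diagonal *)

(* The number of lattice paths in [spaths m h] below. *)
Fixpoint schr (m h : nat) : nat :=
  if m is m'.+1 then \sum_(j < h.+1) (schr m' j.+1 + schr m' j) else 1.

Lemma schrS0 m : schr m.+1 0 = schr m 1 + schr m 0.
Proof. by rewrite /= big_ord1. Qed.

(** Peels off the first step, which is vertical, horizontal or diagonal, in the order of the
    summands. *)
Lemma schrSS m h :
  schr m.+1 h.+1 = schr m.+1 h + (schr m h.+2 + schr m h.+1).
Proof. by rewrite /= big_ord_recr. Qed.

(** First-passage decomposition: the path first rises to depth [h] after [i] columns, and until then
    stays at depth at least [h.+1]. The proof checks that both sides obey the recurrence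
    [schrSS]. *)
Lemma schr_conv m h :
  schr m h.+1 = \sum_(i < m.+1) schr i 0 * schr (m - i) h.
Proof.
elim: m h => [|m IHm] h; first by rewrite big_ord1.
elim: h => [|h IHh]; rewrite big_ord_recr subnn muln1.
  rewrite (eq_bigr (fun i : 'I_m.+1 =>
    schr i 0 * schr (m - i) 1 + schr i 0 * schr (m - i) 0)) => [|i _].
    by rewrite big_split -!IHm schrSS addnC.
  rewrite /= subSn ?leq_ord //. by rewrite schrS0 mulnDr.
rewrite (eq_bigr (fun i : 'I_m.+1 => schr i 0 * schr (m.+1 - i) h +
    (schr i 0 * schr (m - i) h.+2 + schr i 0 * schr (m - i) h.+1))) => [|i _].
  by rewrite !big_split -!IHm schrSS IHh big_ord_recr subnn muln1 addnAC.
by rewrite /= subSn ?leq_ord // schrSS !mulnDr.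
Qed.

Lemma schr_rec m :
  schr m.+1 0 = schr m 0 + \sum_(i < m.+1) schr i 0 * schr (m - i) 0.
Proof. by rewrite schrS0 schr_conv addnC. Qed.

(** * Enumeration of the words that stay below the diagonal *)

Fixpoint stays_below (h : nat) (s : seq (option bool)) : bool :=
  match s with
  | [::] => true
  | Some true :: s' => stays_below h.+1 s'
  | Some false :: s' => if h is h'.+1 then stays_below h' s' else false
  | None :: s' => stays_below h s'
  end.

(** The initial depth [h] is arbitrary because it changes in the induction along the word. *)
Lemma stays_belowE h s :
  all (fun i => end_y (take i s) <= h + end_x (take i s)) (iota 0 (size s).+1)
  = stays_below h s.
Proof.
elim: s h => [|a s IHs] h //.
have -> : iota 0 (size (a :: s)).+1 = 0 :: map (addn 1) (iota 0 (size s).+1).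
  by rewrite -iotaDl.
(* After the shift, index 0 stands for the prefix of length 1, which refutes a vertical first step
   at [h = 0]; this is kept while the index list is generalised. *)
have: 0 \in iota 0 (size s).+1 by rewrite mem_head.
move: (iota _ _) IHs => l IHs l0.
rewrite [LHS]/= all_map /=; case: a => [[]|] /=.
- rewrite -IHs; apply: eq_all => i /=.
  by rewrite /end_x /end_y /= add0n addnA addn1.
- case: h => [|h]; first by apply/allP => /(_ 0 l0); rewrite /= take0.
  rewrite -IHs; apply: eq_all => i /=.
  by rewrite /end_x /end_y /= add0n add1n addSn ltnS.
- rewrite -IHs; apply: eq_all => i /=.
  by rewrite /end_x /end_y /= addnCA leq_add2l.
Qed.

(* The words that take a path [h] units below the diagonal up to it, in [m] columns. *)
Fixpoint spaths (m : nat) : nat -> seq (seq (option bool)) :=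
  if m is m'.+1 then
    fix aux h :=
      (if h is h'.+1 then map (cons (Some false)) (aux h') else [::])
      ++ map (cons (Some true)) (spaths m' h.+1) ++ map (cons None) (spaths m' h)
  else fun h => [:: nseq h (Some false)].

Lemma size_spaths m h : size (spaths m h) = schr m h.
Proof.
elim: m h => // m IHm; elim=> [|h IHh].
  by rewrite schrS0 /= size_cat !size_map !IHm.
by rewrite schrSS -IHh -!IHm /= size_cat !size_map size_cat !size_map.
Qed.

Lemma mem_map_cons (T : eqType) (a b : T) s l :
  (a :: s \in map (cons b) l) = (a == b) && (s \in l).
Proof.
apply/mapP/andP => [[t tl [-> ->]]|[/eqP-> sl]]; first by rewrite eqxx.
by exists s.
Qed.

Lemma nil_map_cons (T : eqType) (b : T) l : ([::] \in map (cons b) l) = false.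
Proof. by apply/mapP => -[]. Qed.

Lemma mem_spaths m h s : (s \in spaths m h) =
  [&& end_x s == m, end_y s == m + h & stays_below h s].
Proof.
elim: s m h => [|a s IHs] [|m] h.
- by rewrite inE /end_x /end_y; case: h.
- by case: h => [|h]; rewrite /= !mem_cat !nil_map_cons.
- rewrite inE; case: h => [|h] /=.
    by case: a => [[]|]; rewrite /end_x /end_y /= ?andbF.
  rewrite eqseq_cons; have := IHs 0 h; rewrite inE /= => ->.
  by case: a => [[]|]; rewrite /end_x /end_y //= !add0n add1n eqSS.
- have -> : (a :: s \in spaths m.+1 h) =
      ((if h is h'.+1 then (a == Some false) &&
          [&& end_x s == m.+1, end_y s == m.+1 + h' & stays_below h' s] else false)
      || ((a == Some true) && [&& end_x s == m, end_y s == m + h.+1 & stays_below h.+1 s]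
      || (a == None) && [&& end_x s == m, end_y s == m + h & stays_below h s])).
    by case: h => [|h]; rewrite !mem_cat !mem_map_cons -?IHs // in_nil.
  case: a => [[]|]; case: h => [|h]; rewrite /end_x /end_y /= ?orbF ?andbF //;
    by rewrite ?add0n ?add1n ?addnS ?addSn ?eqSS.
Qed.

Lemma uniq_spaths m h : uniq (spaths m h).
Proof.
elim: m h => // m IHm; have cons_inj (a : option bool) : injective (cons a) by move=> s t [].
have disj (a b : option bool) l1 l2 : a != b ->
    ~~ has (mem (map (cons a) l1)) (map (cons b) l2).
  move=> /negPf ab; apply/hasPn => _ /mapP[s _ ->] /=.
  by rewrite mem_map_cons eq_sym ab.
elim=> [|h IHh]; rewrite /= !cat_uniq !map_inj_uniq ?IHm ?IHh ?disj //=.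
by rewrite has_cat negb_or !disj.
Qed.

Lemma large_schroederE n : large_schroeder n = schr n 0.
Proof.
rewrite /large_schroeder cardE -(size_map val) -size_spaths.
apply/perm_size/uniq_perm; rewrite ?uniq_spaths //.
  by rewrite map_inj_uniq ?enum_uniq //; apply: val_inj.
move=> s; rewrite mem_spaths addn0 -stays_belowE.
have -> : [&& end_x s == n, end_y s == n & all (fun i => end_y (take i s) <=
    0 + end_x (take i s)) (iota 0 (size s).+1)] = schroeder_path n s by [].
apply/mapP/idP => [[t]|sch]; first by rewrite mem_enum inE => ? ->.
(* The steps that [end_x] omits are vertical and counted by [end_y], so the length is at most
   [end_x s + end_y s]. *)
have size_s : size s <= n.*2.
  case/and3P: sch => /eqP xs /eqP ys _.
  rewrite -addnn -{1}xs -ys -(count_predC (predC1 (Some false)) s).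
  by rewrite /end_x /end_y leq_add2l; apply: sub_count => -[[]|].
by exists (Bseq size_s); rewrite // mem_enum inE.
Qed.

(** * Sets of compatible arcs *)

Section Cliques.
Variables (T : finType) (c : rel T).
Implicit Types (U X A B : {set T}) (x y : T).

(** The relation need not be symmetric, so both orders of a pair are tested; for arcs it will
    express that all maps from one brick to another are zero or injective. *)
Definition is_clique A := [forall x in A, forall y in A, c x y].
Definition cliques U := [set A : {set T} | (A \subset U) && is_clique A].

Lemma is_cliqueP A :
  reflect (forall x y, x \in A -> y \in A -> c x y) (is_clique A).
Proof.
apply: (iffP forall_inP) => cA x; last by move=> xA; apply/forall_inP => y; apply: cA.
by move=> y /cA/forall_inP; apply.
Qed.

Lemma is_cliqueS A B : A \subset B -> is_clique B -> is_clique A.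
Proof.
by move=> /subsetP AB /is_cliqueP cB; apply/is_cliqueP => x y /AB xB /AB; apply: cB.
Qed.

Lemma card_cliques0 : #|cliques set0| = 1.
Proof.
rewrite (_ : cliques set0 = [set set0]) ?cards1 //; apply/setP => A.
rewrite !inE subset0; case: eqP => // ->; apply/is_cliqueP => x y.
by rewrite inE.
Qed.

(** Intersecting with the two parts is a bijection onto pairs of cliques, as no constraint links the
    parts. *)
Lemma card_cliquesU U1 U2 : [disjoint U1 & U2] ->
  (forall x y, x \in U1 -> y \in U2 -> c x y && c y x) ->
  #|cliques (U1 :|: U2)| = #|cliques U1| * #|cliques U2|.
Proof.
move=> dis cU; rewrite -cardsX.
pose f (A : {set T}) := (A :&: U1, A :&: U2).
rewrite -(card_in_imset (f := f)) => [|A B].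
  congr #|pred_of_set _|; apply/setP => -[A1 A2]; rewrite !inE /=.
  apply/imsetP/andP => [[A]|[/andP[s1 c1] /andP[s2 c2]]].
    rewrite inE => /andP[_ cA] [-> ->].
    by rewrite !subsetIr !(is_cliqueS (subsetIl _ _) cA).
  exists (A1 :|: A2).
    rewrite inE setUSS //; apply/is_cliqueP => x y.
    move/is_cliqueP in c1; move/is_cliqueP in c2.
    move/subsetP in s1; move/subsetP in s2; rewrite !inE.
    case/orP=> [xA /orP[yA|yA]|xA /orP[yA|yA]]; [exact: c1| | |exact: c2].
      by have /andP[] := cU x y (s1 _ xA) (s2 _ yA).
    by have /andP[] := cU y x (s1 _ yA) (s2 _ xA).
  have d12 : [disjoint A1 & U2] by apply: disjointWl s1 dis.
  have d21 : [disjoint A2 & U1] by apply: disjointWl s2 _; rewrite disjoint_sym.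
  rewrite /f !setIUl (setIidPl s1) (setIidPl s2).
  by rewrite (disjoint_setI0 d12) (disjoint_setI0 d21) setU0 set0U.
rewrite !inE => /andP[sA _] /andP[sB _] [e1 e2].
by rewrite -(setIidPl sA) -(setIidPl sB) !setIUr e1 e2.
Qed.

(* A clique either avoids [X] or is sorted by its [mu]-largest element in [X]. *)
Lemma card_cliques_max (mu : T -> nat) U X : X \subset U -> reflexive c ->
  (forall x y, x \in X -> y \in X -> c x y -> c y x -> mu x = mu y -> x = y) ->
  #|cliques U| = #|cliques (U :\: X)| + \sum_(x in X) #|cliques
    [set y in U | [&& y != x, c x y, c y x & (y \in X) ==> (mu y < mu x)]]|.
Proof.
move=> XU cxx inj_mu.
pose top x A := (x \in A) && [forall y in A, (y \in X) && (y != x) ==> (mu y < mu x)].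
have one A : A \in cliques U ->
    (A :&: X == set0) + \sum_(x in X) top x A = 1.
  rewrite inE => /andP[AU /is_cliqueP cA].
  case: (set_0Vmem (A :&: X)) => [AX0|[x1 x1AX]].
    rewrite AX0 eqxx big1 // => x xX; rewrite /top.
    by case xA: (x \in A) => //; have := in_set0 x; rewrite -AX0 inE xA xX.
  have -> : (A :&: X == set0) = false by apply/set0Pn; exists x1.
  case: (arg_maxnP (P := [pred x in A :&: X]) mu x1AX) => x0 /=.
  rewrite inE => /andP[xA xX] mx.
  rewrite (bigD1 x0) //= big1 => [|x /andP[x'X x'0]].
    rewrite /top xA; case: forall_inP => // -[] y yA; apply/implyP => /andP[yX yx].
    rewrite ltn_neqAle mx ?inE ?yA // andbT.
    by apply: contraNneq yx => /inj_mu -> //; apply: cA.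
  rewrite /top; case x'A: (x \in A) => //=; case: forall_inP => // /(_ x0 xA).
  rewrite xX eq_sym x'0 /= ltnNge => /negP[].
  by apply: mx; rewrite !inE x'A.
have cnt (P : pred {set T}) :
    \sum_(A in cliques U) (P A : nat) = #|[set A in cliques U | P A]|.
  by rewrite -sum1dep_card big_mkcondr; apply: eq_bigr => A _; case: (P A).
(* Double counting: each clique contributes the sum in [one], and the order of summation is
   exchanged. *)
rewrite -sum1_card -(eq_bigr _ one) big_split exchange_big /=; congr (_ + _).
  rewrite cnt; apply: eq_card => A; rewrite !inE subsetD -setI_eq0.
  by rewrite -andbA [is_clique A && _]andbC andbA.
apply: eq_bigr => x xX; rewrite cnt.
set V := [set y in U | _]; have xV : x \notin V by rewrite inE eqxx /= andbF.
have VU : V \subset U by apply/subsetP => y; rewrite inE => /andP[].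
(* Removing [x] maps the cliques with top [x] bijectively onto the cliques of [V]. *)
rewrite -(card_in_imset (f := fun A => A :\ x)) => [|A B]; last first.
  rewrite !inE => /andP[_ /andP[xA _]] /andP[_ /andP[xB _]] eAB.
  by rewrite -(setD1K xA) eAB setD1K.
apply: eq_card => B; apply/imsetP/idP => [[A]|].
  rewrite !inE => /andP[/andP[/subsetP AU cA] /andP[xA /forall_inP mA]] ->.
  rewrite (is_cliqueS (subsetDl _ _) cA) andbT.
  apply/subsetP => y; rewrite !inE => /andP[yx yA].
  move/is_cliqueP in cA; rewrite AU // yx !cA //=.
  by apply/implyP => yX; have := mA y yA; rewrite yX yx.
rewrite inE => /andP[BV /is_cliqueP cB]; have xB : x \notin B.
  by apply: contraNN xV => /(subsetP BV).
exists (x |: B); last by rewrite setU1K.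
rewrite inE /top !inE eqxx subUset sub1set (subsetP XU) // (subset_trans BV VU) /=.
apply/andP; split.
  apply/is_cliqueP => y z; rewrite !inE => /predU1P[->|yB] /predU1P[->|zB] //.
  - by have := subsetP BV _ zB; rewrite inE => /and4P[].
  - by have := subsetP BV _ yB; rewrite inE => /and5P[].
  - exact: cB.
apply/forall_inP => y; rewrite !inE => /predU1P[->|yB]; first by rewrite eqxx andbF.
by have := subsetP BV _ yB; rewrite inE => /and5P[_ _ _ _ /implyP yX];
  apply/implyP => /andP[/yX].
Qed.

End Cliques.

(** * Arcs on the cycle and the recurrences for their cliques *)

Section Arcs.
Variable n : nat.

(* The arc [(i, l)] covers the [l.+1] vertices [i, i - 1, ..., i - l] of the
   [n]-cycle, and [cdist j i] is the number of steps down from [j] to [i]. *)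
Definition carc := ('I_n * 'I_n)%type.
Implicit Types (x y : carc) (i j v : 'I_n).

Definition cdist j i : nat := if i <= j then j - i else j + n - i.

(** Either the start of [x] lies off [y], or [x] lies within [y]. *)
Definition fits x y : bool :=
  (y.2 < cdist y.1 x.1) || (cdist y.1 x.1 + x.2 <= y.2).

Lemma cdist_lt j i : cdist j i < n.
Proof. by rewrite /cdist; have := ltn_ord i; have := ltn_ord j; case: ifP; lia. Qed.

(** Measuring positions from a base vertex [v] makes cyclic distances piecewise linear, within reach
    of [lia]. *)
Lemma cdistE v j i :
  (cdist v j <= cdist v i /\ cdist j i = cdist v i - cdist v j) \/
  (cdist v i < cdist v j /\ cdist j i = n + cdist v i - cdist v j).
Proof.
rewrite /cdist; have := ltn_ord i; have := ltn_ord j; have := ltn_ord v.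
move: (nat_of_ord i) (nat_of_ord j) (nat_of_ord v) => a b d *.
by case: (leqP a b); case: (leqP b d); case: (leqP a d) => ? ? ?; lia.
Qed.

Lemma cdistxx i : cdist i i = 0.
Proof. by rewrite /cdist leqnn subnn. Qed.

Lemma cdist_inj v : injective (cdist v).
Proof.
move=> i j; have := ltn_ord i; have := ltn_ord j; have := ltn_ord v.
rewrite /cdist; do 2!case: ifP => ?; move=> *; apply/val_inj => /=; lia.
Qed.

Lemma cdist_onto v a : a < n -> exists i, cdist v i = a.
Proof.
move=> an; have vn := ltn_ord v; case: (leqP a v) => av.
  have w : v - a < n by lia.
  by exists (Ordinal w); rewrite /cdist /=; case: ifP => ?; lia.
have w : v + n - a < n by lia.
by exists (Ordinal w); rewrite /cdist /=; case: ifP => ?; lia.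
Qed.

Lemma fitsxx : reflexive fits.
Proof. by move=> x; rewrite /fits cdistxx add0n leqnn orbT. Qed.

(** For [a + m <= n], these are the arcs inside the [m] consecutive vertices that begin [a] steps
    below [v]. *)
Definition segment v a m : {set carc} :=
  [set x : carc | (a <= cdist v x.1) && (cdist v x.1 + x.2 < a + m)].

(** Arcs in disjoint segments never start inside each other, so they fit in both orders. *)
Lemma segmentU_cliques v a b c d : a + b <= c -> c + d <= n ->
  #|cliques fits (segment v a b :|: segment v c d)| =
  #|cliques fits (segment v a b)| * #|cliques fits (segment v c d)|.
Proof.
move=> abc cdn; apply: card_cliquesU.
  rewrite -setI_eq0; apply/eqP/setP => x; rewrite !inE; lia.
move=> -[x1 x2] [y1 y2]; rewrite !inE /fits /=.
have := cdistE v y1 x1; have := cdistE v x1 y1; have := cdist_lt v x1.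
have := cdist_lt v y1; have := ltn_ord x2; have := ltn_ord y2; lia.
Qed.

Lemma card_segment v a m : a + m <= n -> #|cliques fits (segment v a m)| = schr m 0.
Proof.
have [p] := ubnP m; elim: p m a => // p IHp [|m] a ltmp lean.
  rewrite (_ : segment v a 0 = set0) ?card_cliques0 //; apply/setP => x.
  by rewrite !inE; lia.
rewrite schr_rec.
(* Two arcs with the same start that fit in both orders are equal. A clique thus has at most one arc
   from the first vertex, and a constant [mu] suffices. *)
rewrite (card_cliques_max (mu := fun => 0)
  (X := [set x : carc | (cdist v x.1 == a) && (x.2 <= m)])); first last.
- move=> -[x1 x2] [y1 y2]; rewrite !inE /fits /=.
  have := cdistE v y1 x1; have := cdistE v x1 y1.
  move=> d1 d2 /andP[/eqP xa xm] /andP[/eqP ya ym] xy yx _.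
  by congr pair; [apply: (@cdist_inj v); lia|apply: val_inj => /=; lia].
- exact: fitsxx.
- by apply/subsetP => x; rewrite !inE; lia.
congr (_ + _).
  rewrite -(IHp m a.+1); [|lia|lia]; congr #|pred_of_set (cliques _ _)|.
  by apply/setP => x; rewrite !inE; lia.
have an : a < n by lia.
have [w wa] := cdist_onto v an.
rewrite (big_ord_widen n (fun l => schr l 0 * schr (m - l) 0)); last by lia.
transitivity (\sum_(x in [set x : carc | (cdist v x.1 == a) && (x.2 <= m)])
   schr x.2 0 * schr (m - x.2) 0).
  apply: eq_bigr => -[x1 x2]; rewrite inE /= => /andP[/eqP x1a x2m].
  (* The other arcs of the clique start after [x1]: they lie among the [x2] remaining vertices of
     [x] or among the [m - x2] vertices beyond it. *)
  rewrite -(IHp (nat_of_ord x2) a.+1); [|lia|lia].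
  rewrite -(IHp (m - x2) (a + x2).+1); [|lia|lia].
  rewrite -segmentU_cliques; [|lia|lia].
  congr #|pred_of_set (cliques _ _)|; apply/setP => -[y1 y2]; rewrite !inE /fits /=.
  rewrite xpair_eqE -(inj_eq (@cdist_inj v)) -val_eqE /=.
  have := cdistE v y1 x1; have := cdistE v x1 y1.
  have := cdist_lt v y1; have := ltn_ord y2; have := ltn_ord x2; lia.
rewrite (eq_bigl (fun x : carc => (x.1 == w) && (x.2 < m.+1))); last first.
  by move=> x; rewrite inE -wa (inj_eq (@cdist_inj v)).
rewrite -(pair_big (pred1 w) (fun i : 'I_n => i < m.+1)
  (fun (_ : 'I_n) (i : 'I_n) => schr i 0 * schr (m - i) 0)) /=.
by rewrite big_pred1_eq.
Qed.

Lemma card_cyclic_cliques (n_gt0 : 0 < n) : #|cliques fits setT| =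
  schr n.-1 0 + \sum_(l < n) l.+1 * (schr l 0 * schr (n.-1 - l) 0).
Proof.
pose v := Ordinal n_gt0.
(* Of two arcs through [v], one starts inside the other; if they fit in both orders they are nested,
   so equal length makes them equal. *)
rewrite (card_cliques_max (mu := fun x => x.2)
  (X := [set x : carc | cdist x.1 v <= x.2])); first last.
- move=> -[x1 x2] [y1 y2]; rewrite !inE /fits /=.
  have := cdistE v x1 v; have := cdistE v y1 v; rewrite cdistxx.
  have := cdistE v y1 x1; have := cdistE v x1 y1.
  have := cdist_lt v x1; have := cdist_lt v y1 => *.
  by congr pair; [apply: (@cdist_inj v); lia|apply: val_inj => /=; lia].
- exact: fitsxx.
- exact: subsetT.
congr (_ + _).
  rewrite -(@card_segment v 1); last by lia.
  congr #|pred_of_set (cliques _ _)|; apply/setP => -[x1 x2]; rewrite !inE /=.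
  have := cdistE v x1 v; rewrite cdistxx; have := cdist_lt v x1; have := ltn_ord x2. lia.
transitivity (\sum_(x in [set x : carc | cdist x.1 v <= x.2])
   schr x.2 0 * schr (n.-1 - x.2) 0).
  apply: eq_bigr => -[x1 x2]; rewrite inE /= => x2v; have := ltn_ord x2 => x2n.
  (* An arc that reaches [x] from outside would contain [x], hence be a longer arc through [v]; only
     arcs strictly after the start of [x] or disjoint from [x] remain. *)
  rewrite -(@card_segment x1 1 x2); last by lia.
  rewrite -(@card_segment x1 x2.+1 (n.-1 - x2)); last by lia.
  rewrite -segmentU_cliques; [|lia|lia].
  congr #|pred_of_set (cliques _ _)|; apply/setP => -[y1 y2]; rewrite !inE /fits /=.
  rewrite xpair_eqE -(inj_eq (@cdist_inj x1)) -val_eqE /=.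
  have := cdistE x1 y1 x1; have := cdistE x1 y1 v; rewrite cdistxx.
  have := cdist_lt x1 y1; have := ltn_ord y2; have := cdist_lt x1 v; lia.
(* Since [v] is vertex 0, its distance from [x.1] is [x.1]; hence [l.+1] arcs with second component
   [l] pass through it. *)
rewrite (eq_bigl (fun x : carc => x.1 <= x.2)); last first.
  by move=> x; rewrite inE /cdist /= subn0.
rewrite -(pair_big_dep xpredT (fun i j : 'I_n => i <= j)
  (fun (_ : 'I_n) (i : 'I_n) => schr i 0 * schr (n.-1 - i) 0)) /=.
rewrite (exchange_big_dep xpredT) //=; apply: eq_bigr => l _.
rewrite -(big_ord_widen n (fun=> schr l 0 * schr (n.-1 - l) 0) (ltn_ord l)).
by rewrite sum_nat_const card_ord.
Qed.

(** Seen from the vertex [n.-1], the arcs that do not wrap around form one segment of [n]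
    vertices. *)
Lemma card_linear_cliques (n_gt0 : 0 < n) :
  #|cliques fits [set x : carc | x.2 <= x.1]| = schr n 0.
Proof.
have vn : n.-1 < n by rewrite ltn_predL.
rewrite -(@card_segment (Ordinal vn) 0) //; congr #|pred_of_set (cliques _ _)|.
apply/setP => -[x1 x2]; rewrite !inE /cdist /=.
by have := ltn_ord x1; case: ifP; lia.
Qed.
End Arcs.

Local Open Scope ring_scope.

(** * Closed formulas *)

Lemma fact_neq0 n : (n`!)%:R != 0 :> rat.
Proof. by rewrite pnatr_eq0 -lt0n fact_gt0. Qed.

Lemma factSr n : (n.+1`!)%:R = (n%:R + 1) * (n`!)%:R :> rat.
Proof. by rewrite factS natrM -natr1. Qed.

Lemma binE n i : (i <= n)%N ->
  ('C(n, i))%:R = (n`!)%:R / ((i`!)%:R * ((n - i)`!)%:R) :> rat.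
Proof.
by move=> le; rewrite -(bin_fact le) !natrM mulfK // mulf_neq0 ?fact_neq0.
Qed.

Ltac solve_natr_neq0 := rewrite ?fact_neq0 -?natrD ?natr1 -?natrD ?natr1 ?pnatr_eq0 //=.

(* [schr_term m h.+1 j] counts the paths of [spaths m h] with [j] horizontal steps;
   the shift in [h] makes the boundary term [schr_term m 0 j] vanish. *)
Definition schr_term (m h j : nat) : rat :=
  if (j <= m)%N then h%:R * ((m + h + j).-1`!)%:R /
     (((m - j)`!)%:R * (j`!)%:R * ((h + j)`!)%:R) else 0.

Lemma schr_term0 m h :
  schr_term m.+1 h.+1 0 = schr_term m.+1 h 0 + schr_term m h.+1 0.
Proof.
rewrite /schr_term !subn0 !addn0 !addSn !addnS /=.
case: h => [|h]; rewrite ?addn0 ?addnS /= !factSr ?fact0.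
  by field; rewrite !fact_neq0 !natr1 !pnatr_eq0.
rewrite -!natr1 natrD.
by field; rewrite !fact_neq0 !natr1 !pnatr_eq0.
Qed.

(** Refines [schrSS] by the number of horizontal steps; only a horizontal first step lowers it. *)
Lemma schr_termS m h j :
  schr_term m.+1 h.+1 j.+1 =
  schr_term m.+1 h j.+1 + schr_term m h.+2 j + schr_term m h.+1 j.+1.
Proof.
(* For [j > m] every term is 0; for [j = m] no column is left for a diagonal step and the last
   summand is 0. *)
rewrite /schr_term ltnS; case: (ltngtP j m) => [jm|jm|<-]; rewrite ?addr0 //.
  have := subnK jm; set p := (m - j.+1)%N => <-.
  have -> : ((p + j.+1).+1 - j.+1 = p.+1)%N by lia.
  have -> : ((p + j.+1) - j = p.+1)%N by lia.
  have -> : (((p + j.+1).+1 + h.+1 + j.+1).-1 = (p + j + j + h).+3)%N by lia.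
  have -> : (((p + j.+1).+1 + h + j.+1).-1 = (p + j + j + h).+2)%N by lia.
  have -> : ((p + j.+1 + h.+2 + j).-1 = (p + j + j + h).+2)%N by lia.
  have -> : ((p + j.+1 + h.+1 + j.+1).-1 = (p + j + j + h).+2)%N by lia.
  rewrite !addSn !addnS !factSr -!natr1 !natrD.
  by field; solve_natr_neq0.
rewrite !subnn.
have -> : ((j.+1 + h.+1 + j.+1).-1 = (j + j + h).+2)%N by lia.
have -> : ((j.+1 + h + j.+1).-1 = (j + j + h).+1)%N by lia.
have -> : ((j + h.+2 + j).-1 = (j + j + h).+1)%N by lia.
rewrite !addSn !addnS !factSr -!natr1 !natrD.
by field; solve_natr_neq0.
Qed.

(** Each summand is a cycle-lemma count, [h.+1 / (m + h.+1 + j)] times a multinomial coefficient;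
    the proof compares recurrences. *)
Lemma schr_closed m h : (schr m h)%:R = \sum_(j < m.+1) schr_term m h.+1 j.
Proof.
elim: m h => [|m IHm] h.
  rewrite big_ord1 /schr_term !addn0 add0n /= ?subnn factSr -(natr1 h) ?fact0.
  by field; rewrite fact_neq0 natr1 pnatr_eq0.
have step h' : \sum_(j < m.+2) schr_term m.+1 h'.+1 j =
    \sum_(j < m.+2) schr_term m.+1 h' j + (schr m h'.+1)%:R + (schr m h')%:R.
  (* The added summand [j = m.+1] is 0; it gives the sums a common range. *)
  have -> : (schr m h')%:R = \sum_(j < m.+2) schr_term m h'.+1 j.
    by rewrite big_ord_recr /= {2}/schr_term ltnn addr0.
  rewrite IHm !(big_ord_recl m.+1) /= schr_term0.
  rewrite (eq_bigr _ (fun (j : 'I_m.+1) _ => schr_termS m h' j)) !big_split /=.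
  ring.
have T0 : \sum_(j < m.+2) schr_term m.+1 0 j = 0.
  by rewrite big1 // => j _; rewrite /schr_term mul0r mul0r; case: ifP.
elim: h => [|h IHh]; first by rewrite schrS0 step T0 add0r natrD.
by rewrite schrSS step -IHh !natrD addrA.
Qed.

Lemma schr_formula n : (schr n 0)%:R =
  \sum_(i < n.+1) (i.+1)%:R^-1 * ('C(n, i))%:R * ('C(n + i, i))%:R :> rat.
Proof.
rewrite schr_closed; apply: eq_bigr => i _; have le := leq_ord i.
rewrite /schr_term le !binE ?leq_addl // addnK addn1 add1n addSn /=.
rewrite factSr -natr1; field.
by rewrite !fact_neq0 nat1r pnatr_eq0.
Qed.

(* The summands are Gosper-summable once the two sides are combined. *)
Lemma schr_cyclic_formula m :
  (schr m 0 * 2 + m.+2 * \sum_(i < m.+1) schr i 0 * schr (m - i) 0 =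
   4 * \sum_(i < m.+1) 'C(m, i) * 'C(m.+1 + i, i))%N.
Proof.
apply/eqP; rewrite -(eqr_nat rat) natrD !natrM.
have -> : (\sum_(i < m.+1) schr i 0 * schr (m - i) 0)%N%:R =
    (schr m.+1 0)%:R - (schr m 0)%:R :> rat.
  by rewrite schr_rec natrD addrC addKr.
rewrite (schr_formula m.+1) big_ord_recr (schr_formula m) natr_sum /=.
(* Gosper antidifference of [f], the summand of [(m+2) S_(m+1) - m S_m] minus that of the right-hand
   side. *)
pose G i : rat := - (2 * i%:R ^+ 2 * ((m + i)`!)%:R) /
  ((m%:R + 1) * ((m.+1 - i)`!)%:R * (i`!)%:R ^+ 2).
pose f (i : nat) : rat := (m%:R + 2) * ((i.+1)%:R^-1 * ('C(m.+1, i))%:R * ('C(m.+1 + i, i))%:R)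
  - m%:R * ((i.+1)%:R^-1 * ('C(m, i))%:R * ('C(m + i, i))%:R)
  - 4 * ('C(m, i) * 'C(m.+1 + i, i))%:R.
have fG (i : 'I_m.+1) : f i = G i.+1 - G i.
  case: i => i /= le; rewrite ltnS in le; rewrite /f /G natrM !binE ?leq_addl //; last by lia.
  rewrite !addnK addnS subSS; have := subnK le; set p := (m - i)%N => <-.
  have -> : ((p + i).+1 - i = p.+1)%N by lia.
  rewrite !addSn !factSr -!natr1 !natrD.
  by field; solve_natr_neq0.
have sumf : \sum_(i < m.+1) f i = G m.+1.
  rewrite (eq_bigr _ (fun i _ => fG i)).
  rewrite -(big_mkord xpredT (fun i => G i.+1 - G i)) telescope_sumr //.
  by rewrite [G 0]/G expr0n mulr0 mul0r oppr0 mul0r subr0.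
have mS : m.+2%:R = m%:R + 2 :> rat by rewrite -addn2 natrD.
(* [S_(m+1)] has one summand more than the other sums; it cancels the telescoped value [G m.+1]. *)
have last : m.+2%:R * (m.+2%:R^-1 * 'C(m.+1, m.+1)%:R * 'C(m.+1 + m.+1, m.+1)%:R)
    = - G m.+1.
  rewrite /G binn binE ?leq_addl // addnK subnn addSn addnS !factSr fact0.
  rewrite -!natr1 !natrD.
  by field; solve_natr_neq0.
rewrite !sumrB -!mulr_sumr in sumf.
rewrite -mS in sumf; apply/eqP; rewrite mulrBr [m.+2%:R * (_ + _)]mulrDr last -sumf mS.
by ring.
Qed.

Lemma cyclic_cliques_formula n : (0 < n)%N ->
  #|cliques (@fits n) setT| = (2 * \sum_(i < n) 'C(n.-1, i) * 'C(n + i, i))%N.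
Proof.
case: n => // m _; apply/(@double_inj).
rewrite card_cyclic_cliques //= -muln2 -[RHS]mul2n mulnA.
rewrite -schr_cyclic_formula mulnDl; congr (_ + _)%N.
(* Adding the sum to its reversal [l -> m - l] combines the weights [l + 1] and [m - l + 1] into
   [m + 2]. *)
rewrite muln2 -addnn {2}(reindex_inj rev_ord_inj) /= -big_split /= big_distrr /=.
apply: eq_bigr => l _; have := leq_ord l => lm.
rewrite subSS subKn // [(schr (m - l) 0 * _)%N]mulnC -mulnDl.
by congr (_ * _)%N; lia.
Qed.

(** * Uniserial modules and bricks *)

Section Functional.
Variables (k : fieldType) (V : lmodType k) (I : finType) (g : I -> V).
Hypothesis gspan : forall x, exists c : I -> k, x = \sum_i c i *: g i.

(** A minimal spanning subfamily is a basis, and [phi] is a coordinate in it, normalised at [y]. *)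
Lemma exists_functional y : y != 0 ->
  exists phi : V -> k,
    [/\ forall u v, phi (u + v) = phi u + phi v, forall a u, phi (a *: u) = a * phi u
      & phi y = 1].
Proof.
move=> y0; pose P (J : {set I}) :=
  `[< forall x, exists c : I -> k, x = \sum_(i in J) c i *: g i >].
have [|J Jmin] := @ex_minset _ P.
  exists setT; apply/asboolP => x; have [c ->] := gspan x.
  by exists c; apply: eq_bigl => i; rewrite inE.
have /asboolP PJ := minsetp Jmin.
have free c : \sum_(i in J) c i *: g i = 0 -> forall j, j \in J -> c j = 0.
  move=> c0 j jJ; apply/eqP/negPn/negP => cj.
  suff /(minsetinf Jmin)/(_ (subD1set _ _)) JE : P (J :\ j).
    by have := setD11 j J; rewrite JE jJ.
  apply/asboolP => x; have [d ->] := PJ x.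
  (* Subtracting a multiple of the relation [c] kills the coefficient at [j], so [J] without [j]
     would still span. *)
  exists (fun i => d i - d j / c j * c i).
  have : \sum_(i in J) (d i - d j / c j * c i) *: g i = \sum_(i in J) d i *: g i.
    rewrite (eq_bigr (fun i => d i *: g i - (d j / c j) *: (c i *: g i))).
      by rewrite sumrB -scaler_sumr c0 scaler0 subr0.
    by move=> i _; rewrite scalerBl scalerA.
  rewrite (bigD1 j jJ) /= divfK // subrr scale0r add0r => <-.
  by apply: eq_bigl => i; rewrite !inE andbC.
have [co coE] := choice PJ.
have uniqc c d : \sum_(i in J) c i *: g i = \sum_(i in J) d i *: g i ->
    forall j, j \in J -> c j = d j.
  move=> cd j jJ; apply/eqP; rewrite -subr_eq0; apply/eqP.
  apply: (free (fun i => c i - d i)) jJ.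
  under eq_bigr do rewrite scalerBl.
  by rewrite sumrB cd subrr.
have [j /andP[jJ cj]] : exists j, (j \in J) && (co y j != 0).
  apply/existsP; apply: contraNT y0; rewrite negb_exists => /forallP c0.
  rewrite (coE y) big1 // => i iJ; have := c0 i.
  by rewrite iJ negbK => /eqP->; rewrite scale0r.
exists (fun x => co x j / co y j); split=> [u v|a u|]; last by rewrite divff.
  rewrite -mulrDl; congr (_ / _); apply: (uniqc (co (u + v)) (fun i => co u i + co v i)) jJ.
  rewrite -coE; under eq_bigr do rewrite scalerDl.
  by rewrite big_split /= -!coE.
rewrite mulrA; congr (_ / _); apply: (uniqc (co (a *: u)) (fun i => a * co u i)) jJ.
rewrite -coE; under eq_bigr do rewrite -scalerA.
by rewrite -scaler_sumr -coE.
Qed.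
End Functional.

(** A module structure as a value, so that one additive group can carry several, each on its own
    copy [scaled]. *)
Record scaling (R : pzRingType) (V : zmodType) := Scaling {
  scale_fun :> R -> V -> V;
  scale_funA : forall a b v, scale_fun a (scale_fun b v) = scale_fun (a * b) v;
  scale_fun1 : left_id 1 scale_fun;
  scale_funDr : right_distributive scale_fun +%R;
  scale_funDl : forall v, {morph scale_fun^~ v : a b / a + b} }.

Definition scaled (R : pzRingType) (V : zmodType) (sc : scaling R V) : Type := V.

HB.instance Definition _ R V (sc : scaling R V) := GRing.Zmodule.on (scaled sc).
HB.instance Definition _ R V (sc : scaling R V) :=
  GRing.Zmodule_isLmodule.Build R (scaled sc)
    (scale_funA sc) (scale_fun1 sc) (scale_funDr sc) (scale_funDl sc).

Section Isomorphic.
Variable L : pzRingType.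
Implicit Types M N : fgmod L.

Lemma isomorphic_refl M : isomorphic M M.
Proof. by exists idfun, idfun. Qed.

Lemma isomorphic_sym M N : isomorphic M N -> isomorphic N M.
Proof. by move=> [f [g [fg gf]]]; exists g, f. Qed.

Lemma isomorphic_trans M N P : isomorphic M N -> isomorphic N P -> isomorphic M P.
Proof.
move=> [f [f' [ff' f'f]]] [g [g' [gg' g'g]]]; exists (g \o f), (f' \o g').
by split; apply: can_comp.
Qed.

Lemma iso_classP M N : isomorphic M N <-> iso_class M = iso_class N.
Proof.
split=> [MN|MN]; last by rewrite -/(iso_class M N) MN; exact: isomorphic_refl.
apply/funext => P; apply/propext; split; apply: isomorphic_trans => //.
exact: isomorphic_sym.
Qed.

Lemma exists_linear (M N : lmodType L) (f : M -> N) :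
  (forall x y, f (x + y) = f x + f y) -> (forall a x, f (a *: x) = a *: f x) ->
  exists g : {linear M -> N}, forall x, g x = f x.
Proof.
move=> fD fZ; have fl : linear f by move=> a x y; rewrite fD fZ.
pose fL := GRing.isLinear.Build _ _ _ _ f fl.
by exists (HB.pack f fL : {linear M -> N}).
Qed.
End Isomorphic.

(** * Right modules from matrices acting on row vectors *)

Record matrep (k : fieldType) (L : pzRingType) (m : nat) := MatRep {
  mrep :> L -> 'M[k]_m;
  mrepD : forall a b, mrep (a + b) = mrep a + mrep b;
  mrepM : forall a b, mrep (a * b) = mrep a *m mrep b;
  mrep1 : mrep 1 = 1%:M }.

Section RepMod.
Variables (k : fieldType) (L : pzRingType) (m : nat) (R : matrep k L m).

Definition row_scaling : scaling L^c 'rV[k]_m.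
Proof.
exists (fun (a : L^c) z => z *m R a).
- by move=> a b v; rewrite -mulmxA -mrepM.
- by move=> z; rewrite mrep1 mulmx1.
- by move=> a y z; rewrite mulmxDl.
- by move=> z a b; rewrite mrepD mulmxDr.
Defined.

Definition repmod := scaled row_scaling.

Lemma repmod_fin_gen (io : k -> L) : (forall c, R (io c) = c%:M) -> fin_gen repmod.
Proof.
move=> Rio; exists [seq delta_mx 0 i : repmod | i <- enum 'I_m] => z.
set s := map _ _; have size_s : size s = m by rewrite size_map size_enum_ord.
(* Coordinates on all naturals bridge ['I_(size s)] and ['I_m]; the default 0 is never met, as the
   sizes agree. *)
pose zn i := if insub i is Some j then (z : 'rV[k]_m) 0 j else 0.
exists (fun i => io (zn i)); rewrite -(big_mkord xpredT (fun i => (io (zn i) : L^c) *: s`_i)).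
rewrite size_s big_mkord [LHS](row_sum_delta (z : 'rV[k]_m)); apply: eq_bigr => i _.
rewrite (nth_map i) ?size_enum_ord // nth_ord_enum /zn valK.
by rewrite -[RHS]/(delta_mx 0 i *m R (io ((z : 'rV[k]_m) 0 i))) Rio mul_mx_scalar.
Qed.
End RepMod.

(** * Iterated predecessors on the cycle *)

Section Down.
Variable n : nat.
Implicit Types i j v : 'I_n.

Definition down i t : 'I_n := iter t (@ord_pred n) i.

Lemma downD i s t : down i (s + t) = down (down i s) t.
Proof. by rewrite /down addnC iterD. Qed.

Lemma val_down i t : (t <= n)%N -> down i t = (if t <= i then i - t else i + n - t)%N :> nat.
Proof.
elim: t => [|t IHt] tn; first by rewrite /= subn0.
rewrite /down iterS -/(down i t) /= (IHt (ltnW tn)); have := ltn_ord i => lin.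
case: (leqP t i) => ti; case: (leqP t.+1 i) => ti'; try lia.
- rewrite (_ : (_ + n).-1 = (i - t.+1) + n)%N; last by lia.
  by rewrite modnDr modn_small; lia.
- by rewrite modn_small; lia.
rewrite (_ : (_ + n).-1 = (i + n - t.+1) + n)%N; last by lia.
by rewrite modnDr modn_small; lia.
Qed.

Lemma down_eq i j t : (t < n)%N -> (down j t == i) = (t == cdist j i).
Proof.
move=> tn; rewrite -val_eqE /= (val_down _ (ltnW tn)) /cdist.
have := ltn_ord i; have := ltn_ord j; case: (leqP i j); case: (leqP t j); lia.
Qed.
End Down.

(** * Algebras spanned by descending paths, their standard modules and their bricks *)

Section ArcAlgebra.
Variables (k : fieldType) (n : nat).

(** Action on the uniserial module of [x], whose basis vector [s] sits at the vertex [down x.1 s]: a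
    path of length [t] from that vertex moves it to position [s + t]. *)
Definition path_mx (x : carc n) (v : 'I_n) (t : nat) : 'M[k]_(x.2.+1) :=
  \matrix_(s, u) ((down x.1 s == v) && (u == s + t :> nat)%N)%:R.

(* [arc_pth v t] is the path of length [t] starting at [v], if there is one in the
   algebra, and [0] otherwise. *)
Record arc_algebra (L : pzRingType) (U : {set carc n}) := ArcAlgebra {
  arc_io : k -> L;
  arc_pth : 'I_n -> nat -> L;
  arc_rep : forall x : carc n, matrep k L x.2.+1;
  ioD : forall a b, arc_io (a + b) = arc_io a + arc_io b;
  ioM : forall a b, arc_io (a * b) = arc_io a * arc_io b;
  io1 : arc_io 1 = 1;
  io_pth : forall c v t, arc_io c * arc_pth v t = arc_pth v t * arc_io c;
  pthM : forall v t w s,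
    arc_pth v t * arc_pth w s = if w == down v t then arc_pth v (t + s) else 0;
  sum_pth : \sum_v arc_pth v 0 = 1;
  pth_neq0 : forall v t, arc_pth v t != 0 -> exists2 l : 'I_n, t = l & (v, l) \in U;
  pth_ind : forall P : L -> Prop, P 0 -> (forall a b, P a -> P b -> P (a + b)) ->
    (forall c v t, P (arc_io c * arc_pth v t)) -> forall a, P a;
  rep_io : forall x c, arc_rep x (arc_io c) = c%:M;
  rep_pth : forall x v t, x \in U -> arc_rep x (arc_pth v t) = path_mx x v t }.

Arguments pth_ind [L U] _ _ _ _ _ _.

Variables (L : pzRingType) (U : {set carc n}) (D : arc_algebra L U).
Local Notation io := (arc_io D).
Local Notation pth := (arc_pth D).
Local Notation rep := (arc_rep D).

Definition act (M : lmodType L^c) (z : M) (a : L) : M := (a : L^c) *: z.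
Local Notation "z |> a" := (act z a) (at level 40, left associativity).

Section Act.
Variable M : lmodType L^c.
Implicit Types (z : M) (a b : L).

Lemma actM z a b : z |> (a * b) = z |> a |> b.
Proof. by rewrite /act scalerA. Qed.

Lemma actDr z a b : z |> (a + b) = z |> a + z |> b.
Proof. exact: scalerDl. Qed.

Lemma actDl z y a : (z + y) |> a = z |> a + y |> a.
Proof. exact: scalerDr. Qed.

Lemma act1 z : z |> 1 = z.
Proof. exact: scale1r. Qed.

Lemma act0 z : z |> 0 = 0.
Proof. exact: scale0r. Qed.

Lemma act_suml I (r : seq I) (P : pred I) (F : I -> M) a :
  (\sum_(i <- r | P i) F i) |> a = \sum_(i <- r | P i) F i |> a.
Proof. exact: scaler_sumr. Qed.

Lemma act_sumr I (r : seq I) (P : pred I) (F : I -> L) z :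
  z |> (\sum_(i <- r | P i) F i) = \sum_(i <- r | P i) z |> F i.
Proof. exact: scaler_suml. Qed.

Lemma act_pth_io z v t c : z |> pth v t |> io c = z |> io c |> pth v t.
Proof. by rewrite -!actM io_pth. Qed.

Definition io_scaling : scaling k M.
Proof.
exists (fun c z => z |> io c).
- by move=> a b v; rewrite -actM -ioM mulrC.
- by move=> z; rewrite io1 act1.
- by move=> a y z; rewrite actDl.
- by move=> z a b; rewrite ioD actDr.
Defined.

End Act.

(** By [pth_ind], an additive map need only commute with scalars and paths. *)
Lemma exists_arc_linear (M N : lmodType L^c) (f : M -> N) :
  (forall x y, f (x + y) = f x + f y) -> (forall c z, f (z |> io c) = f z |> io c) ->
  (forall v t z, f (z |> pth v t) = f z |> pth v t) ->
  exists g : {linear M -> N}, forall x, g x = f x.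
Proof.
move=> fD fio fpth; apply: exists_linear (fD) _ => a x; rewrite -!/(act _ a).
move: a x; apply: (pth_ind D (fun a => forall x : M, f (x |> a) = f x |> a)).
- by move=> x; rewrite !act0; apply: (addrI (f 0)); rewrite -fD !addr0.
- by move=> b c fb fc x; rewrite !actDr fD fb fc.
- by move=> c v t x; rewrite !actM fpth fio.
Qed.

Lemma linear_act (M N : lmodType L^c) (f : {linear M -> N}) z a : f (z |> a) = f z |> a.
Proof. exact: linearZ. Qed.

(** Nonzero paths have length below [n], so [L], and with it [M], has finite dimension over [k]. *)
Lemma pth_span (M : fgmod L) : exists (I : finType) (g : I -> M),
  forall z, exists c : I -> k, z = \sum_i g i |> io (c i).
Proof.
have span a : exists c : 'I_n * 'I_n -> k, a = \sum_p io (c p) * pth p.1 p.2.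
  have io0 : io 0 = 0 by apply: (addrI (io 0)); rewrite -ioD !addr0.
  move: a; apply: (pth_ind D (fun a => exists c : 'I_n * 'I_n -> k,
    a = \sum_p io (c p) * pth p.1 p.2)).
  - by exists (fun=> 0); rewrite big1 // => p _; rewrite io0 mul0r.
  - move=> a b [c ->] [d ->]; exists (fun p => c p + d p).
    by rewrite -big_split /=; apply: eq_bigr => p _; rewrite ioD mulrDl.
  - move=> c v t; have [->|/pth_neq0[l -> _]] := eqVneq (pth v t) 0.
      by exists (fun=> 0); rewrite mulr0 big1 // => p _; rewrite io0 mul0r.
    exists (fun p => if p == (v, l) then c else 0).
    rewrite (bigD1 (v, l)) //= eqxx big1 ?addr0 // => p /negPf->.
    by rewrite io0 mul0r.
have [s sP] := fgmodP M; have [co coE] := choice span.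
exists ('I_(size s) * ('I_n * 'I_n))%type,
  (fun p : 'I_(size s) * ('I_n * 'I_n) => s`_p.1 |> pth p.2.1 p.2.2) => z.
have [c ->] := sP z; exists (fun p => co (c p.1) p.2).
rewrite -(pair_big xpredT xpredT (fun (i : 'I_(size s)) (p : 'I_n * 'I_n) =>
  s`_i |> pth p.1 p.2 |> io (co (c i) p))) /=.
apply: eq_bigr => i _; rewrite -[LHS]/(s`_i |> c i) {1}(coE (c i)) act_sumr.
by apply: eq_bigr => p _; rewrite actM act_pth_io.
Qed.

Definition stdmod (x : carc n) : fgmod L := FgMod (repmod_fin_gen (rep_io D x)).

Section Coord.
Variable x : carc n.
Implicit Types z : stdmod x.

(** Indexing by all naturals, with 0 past the end, lets modules of different lengths be compared
    without casts. *)
Definition coord z (s : nat) : k :=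
  if (s <= x.2)%N then (z : 'rV[k]_(x.2.+1)) 0 (inord s) else 0.

Definition vec (F : nat -> k) : stdmod x := (\row_(s < x.2.+1) F s : 'rV[k]_(x.2.+1)).

Lemma coord_vec F s : coord (vec F) s = if (s <= x.2)%N then F s else 0.
Proof. by rewrite /coord; case: leqP => // sx; rewrite mxE inordK. Qed.

Lemma coord_inj z z' : coord z =1 coord z' -> z = z'.
Proof.
move=> zz'; apply/rowP => s; have := zz' s.
by rewrite /coord leq_ord inord_val.
Qed.

Lemma coordD z z' s : coord (z + z') s = coord z s + coord z' s.
Proof. by rewrite /coord; case: leqP; rewrite ?addr0 // mxE. Qed.

Lemma coord0 s : coord 0 s = 0.
Proof. by rewrite /coord mxE if_same. Qed.

Lemma coord_sum (I : Type) (r : seq I) (P : pred I) (F : I -> stdmod x) s :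
  coord (\sum_(i <- r | P i) F i) s = \sum_(i <- r | P i) coord (F i) s.
Proof. by apply: (big_morph (coord^~ s)) => [y z|]; rewrite ?coordD ?coord0. Qed.

Lemma coord_out z s : (x.2 < s)%N -> coord z s = 0.
Proof. by rewrite /coord; case: leqP. Qed.

Lemma coord_io z c s : coord (z |> io c) s = coord z s * c.
Proof.
rewrite /coord; case: leqP => _; last by rewrite mul0r.
by rewrite /act -[_ *: _]/(_ *m rep x (io c)) rep_io mul_mx_scalar mxE mulrC.
Qed.

Hypothesis xU : x \in U.

Lemma coord_pth z v t s : coord (z |> pth v t) s =
  if [&& t <= s, s <= x.2 & down x.1 (s - t) == v]%N then coord z (s - t) else 0.
Proof.
rewrite {1}/coord; have [sx|_] := leqP s x.2; last by rewrite andbF.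
rewrite /act -[_ *: _]/(_ *m rep x (pth v t)) rep_pth // mxE.
have [ts|ts] := leqP t s; last first.
  rewrite big1 // => u _; rewrite mxE inordK // (_ : (s == u + t)%N = false).
    by rewrite andbF mulr0.
  by lia.
rewrite (bigD1 (inord (s - t))) //= big1 ?addr0 => [|u us].
  rewrite mxE !inordK; [|lia|lia]; rewrite subnK // eqxx andbT.
  by rewrite /coord (leq_trans (leq_subr t s) sx); case: ifP => _; rewrite ?mulr1 ?mulr0.
rewrite mxE inordK //; case: (_ =P _ :> nat) => [sut|_]; last by rewrite andbF mulr0.
by case/eqP: us; apply/val_inj; rewrite /= inordK //; lia.
Qed.

Definition gen : stdmod x := vec (fun s => (s == 0)%:R).

Lemma coord_gen s : coord gen s = (s == 0)%:R.
Proof. by rewrite coord_vec; case: leqP => //; case: s. Qed.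

Lemma coord_gen_pth t s :
  coord (gen |> pth x.1 t) s = ((s <= x.2)%N && (s == t))%:R.
Proof.
rewrite coord_pth coord_gen subn_eq0 eqn_leq.
have [ts|ts] := leqP t s; rewrite ?andbF //=.
have [sx|//] := leqP s x.2; case: leqP => //= st; last by case: ifP.
by rewrite (_ : (s - t = 0)%N) ?eqxx //; lia.
Qed.

Lemma gen_span z : z = \sum_(s < x.2.+1) gen |> pth x.1 s |> io (coord z s).
Proof.
apply: coord_inj => u; rewrite coord_sum.
under eq_bigr do rewrite coord_io coord_gen_pth.
have [ux|ux] := leqP u x.2; last by rewrite coord_out // big1 // => s _; rewrite mul0r.
rewrite (bigD1 (inord u)) //= inordK // eqxx mul1r big1 ?addr0 // => s su.
case: eqP => [us|_]; last by rewrite mul0r.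
by case/eqP: su; apply/val_inj; rewrite /= inordK.
Qed.
End Coord.

(** The image of the generator determines [f] and sits at the vertex [x.1], which [y] meets at most
    once, at position [t]; one scalar remains. *)
Lemma stdmod_hom x y (f : {linear stdmod x -> stdmod y}) (t := cdist y.1 x.1) :
  x \in U -> y \in U -> exists c : k,
    (forall z u, coord (f z) u =
       if (t <= u <= y.2)%N then coord z (u - t) * c else 0) /\
    ((t + x.2 < y.2)%N -> c = 0).
Proof.
move=> xU yU; pose w := f (gen x); exists (coord w t).
(* The trivial path at [x.1] fixes the generator, hence its image. *)
have wE : w = w |> pth x.1 0.
  rewrite /w -linear_act; congr (f _); apply: coord_inj => s.
  by rewrite coord_gen_pth // coord_gen; case: s => //= s; rewrite andbF.
have w0 u : u != t -> coord w u = 0.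
  move=> ut; rewrite wE coord_pth //= subn0; case: andP => // -[uy].
  rewrite down_eq ?(negPf ut) //; exact: leq_ltn_trans uy (ltn_ord _).
have fpth s u : coord (f (gen x |> pth x.1 s)) u =
    if (u <= y.2)%N && (u == s + t)%N then coord w t else 0.
  rewrite linear_act coord_pth //; have [uy|_] := leqP u y.2; last by rewrite andbF.
  have [su|su] := leqP s u; last by rewrite ifF //=; lia.
  rewrite down_eq; last by have := ltn_ord y.2; lia.
  rewrite -/t /= -(eqn_add2r s) subnK // [(t + s)%N]addnC.
  by case: eqP => // ->; rewrite addKn.
split=> [z u|tlt].
  rewrite {1}(gen_span xU z) linear_sum coord_sum.
  under eq_bigr do rewrite linear_act coord_io fpth.
  have [uy|_] := leqP u y.2; last by rewrite andbF big1 // => s _; rewrite mul0r.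
  have [tu|tu] := leqP t u; last first.
    by rewrite big1 // => s _; case: eqP => [|_]; rewrite ?mul0r //; lia.
  have [ux|ux] := leqP (u - t) x.2; last first.
    rewrite (coord_out z ux) mul0r big1 // => s _.
    by case: eqP => [us|_]; rewrite ?mul0r //; have := ltn_ord s; lia.
  rewrite (bigD1 (inord (u - t))) //= inordK // subnK // eqxx big1.
    by rewrite addr0 mulrC.
  move=> s su; case: eqP => [us|_]; last by rewrite mul0r.
  by case/eqP: su; apply/val_inj; rewrite /= inordK //; lia.
(* A path of length [x.2.+1] kills the generator but moves position [t] to one still inside [y]. *)
have := fpth x.2.+1 (x.2.+1 + t)%N; rewrite eqxx andbT ifT; last by lia.
move=> <-; rewrite (_ : _ |> _ = 0) ?linear0 ?coord0 //.
by apply: coord_inj => s; rewrite coord_gen_pth // coord0; case: leqP => //= ?; rewrite ltn_eqF.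
Qed.

(** If [x] lies within [y], the shift loses no coordinate and is injective once its scalar is
    nonzero; if [x] starts off [y], nothing is hit. *)
Lemma stdmod_hom_fits x y (f : {linear stdmod x -> stdmod y}) :
  x \in U -> y \in U -> fits x y -> (forall z, f z = 0) \/ injective f.
Proof.
move=> xU yU; rewrite /fits; set t := cdist _ _ => xy.
have [c [fE c0]] := stdmod_hom f xU yU; rewrite -/t in fE c0.
have [c_eq0|cN0] := eqVneq c 0.
  left=> z; apply: coord_inj => u; rewrite fE coord0 c_eq0 mulr0; by case: ifP.
have [ty|ty] := leqP t y.2; last first.
  left=> z; apply: coord_inj => u; rewrite fE coord0 ifF //; lia.
right=> z z' /(congr1 (@coord y)) ff; apply: coord_inj => s.
have [sx|sx] := leqP s x.2; last by rewrite !coord_out.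
have stP : (t <= s + t <= y.2)%N by lia.
by have := congr1 (fun g => g (s + t)%N) ff; rewrite !fE !stP !addnK; apply: mulIf.
Qed.

(** The witness is the shift by [t] cut off at the end of [y]: it keeps the generator and kills the
    last basis vector. *)
Lemma stdmod_hom_not_fits x y : x \in U -> y \in U -> ~~ fits x y ->
  exists f : {linear stdmod x -> stdmod y}, ~ ((forall z, f z = 0) \/ injective f).
Proof.
move=> xU yU; rewrite /fits negb_or -leqNgt -ltnNge; set t := cdist _ _ => /andP[ty yx].
have down_t : down y.1 t = x.1 by apply/eqP; rewrite down_eq // cdist_lt.
pose F (z : stdmod x) : stdmod y := vec y (fun u => if (t <= u)%N then coord z (u - t) else 0).
have FE z u : coord (F z) u = if (t <= u <= y.2)%N then coord z (u - t) else 0.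
  by rewrite coord_vec andbC; case: (leqP u y.2).
have [f fE] : exists f : {linear stdmod x -> stdmod y}, forall z, f z = F z.
  apply: exists_arc_linear => [z z'|c z|v s z]; apply: coord_inj => u.
  - by rewrite coordD !FE coordD; case: ifP; rewrite ?addr0.
  - by rewrite coord_io !FE coord_io; case: ifP; rewrite ?mul0r.
  rewrite coord_pth // !FE coord_pth //.
  have [uy|uy] := leqP u y.2; last by rewrite !andbF.
  have [tsu|tsu] := leqP (t + s) u; last first.
    by do 4?[case: ifP => //]; lia.
  have [tu sut su] : [/\ t <= u, s <= u - t & s <= u]%N by split; lia.
  have [tus usy] : (t <= u - s)%N /\ (u - s <= y.2)%N by split; lia.
  have utx : (u - t <= x.2)%N by rewrite leq_subLR (leq_trans uy (ltnW yx)).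
  have tuts : (t + (u - t - s) = u - s)%N by lia.
  by rewrite tu sut su tus usy utx -down_t -downD tuts subnAC.
exists f => -[f0|finj].
  have := coord0 y t; rewrite -(f0 (gen x)) fE FE leqnn ty.
  by rewrite subnn coord_gen => /eqP; rewrite oner_eq0.
have := @finj (vec x (fun s => (s == x.2 :> nat)%:R)) 0.
rewrite linear0 => /(_ _)/(congr1 (fun z => coord z x.2)) H.
have : coord (vec x (fun s => (s == x.2 :> nat)%:R)) x.2 = coord (0 : stdmod x) x.2.
  apply: H; apply: coord_inj => u; rewrite fE FE coord0.
  case: andP => // -[tu uy]; rewrite coord_vec; case: leqP => // ux.
  by rewrite ltn_eqF // ltn_subLR // (leq_ltn_trans uy).
by rewrite coord0 coord_vec leqnn eqxx => /eqP; rewrite oner_eq0.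
Qed.

(** For equal arcs the shift is by 0, so every endomorphism is a scalar. *)
Lemma stdmod_brick x : x \in U -> brick (stdmod x).
Proof.
move=> xU; split.
  exists (gen x) => /(congr1 (fun z => coord z 0)).
  by rewrite coord0 coord_gen => /eqP; rewrite oner_eq0.
move=> f [z0 fz0]; have [c [fE _]] := stdmod_hom f xU xU.
rewrite cdistxx in fE.
have fc z : f z = z |> io c.
  apply: coord_inj => u; rewrite fE coord_io subn0 /=; case: leqP => // ux.
  by rewrite coord_out // mul0r.
have c0 : c != 0.
  apply: contra_notN fz0 => /eqP c0; apply: coord_inj => u.
  by rewrite fc coord_io coord0 c0 mulr0.
have [g gE] : exists g : {linear stdmod x -> stdmod x}, forall z, g z = z |> io c^-1.
  apply: exists_arc_linear => [z z'|d z|v t z]; first exact: actDl.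
    by rewrite -!actM -!ioM mulrC.
  by rewrite act_pth_io.
by exists g; split=> z; rewrite fc gE -actM -ioM ?divff ?mulVf // io1 act1.
Qed.

(** An isomorphism cannot kill the last basis vector, so each arc lies within the other. *)
Lemma stdmod_iso_inj x y : x \in U -> y \in U ->
  isomorphic (stdmod x) (stdmod y) -> x = y.
Proof.
have mono x' y' : x' \in U -> y' \in U -> isomorphic (stdmod x') (stdmod y') ->
    (cdist y'.1 x'.1 + x'.2 <= y'.2)%N.
  move=> xU yU [f [g [fK _]]]; have [c [fE _]] := stdmod_hom f xU yU.
  rewrite leqNgt; apply/negP => lt.
  have := congr1 (fun z => coord z x'.2) (fK (vec x' (fun s => (s == x'.2 :> nat)%:R))).
  rewrite (_ : f _ = 0) ?linear0 ?coord0 ?coord_vec ?leqnn ?eqxx.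
    by move/esym/eqP; rewrite oner_eq0.
  apply: coord_inj => u; rewrite fE coord0; case: andP => // -[tu uy].
  rewrite coord_vec; case: leqP => // ux; rewrite ?mul0r //.
  by rewrite ltn_eqF ?mul0r // ltn_subLR // (leq_ltn_trans uy).
move=> xU yU xy; have := mono _ _ xU yU xy.
have := mono _ _ yU xU (isomorphic_sym xy).
case: x y xU yU xy => [x1 x2] [y1 y2] /= _ _ _ h1 h2.
congr pair; last by apply/val_inj => /=; lia.
by apply: (@cdist_inj n y1); rewrite cdistxx; lia.
Qed.

Lemma down_inj t : injective (fun v : 'I_n => down v t).
Proof.
by elim: t => // t IHt v w; rewrite /down !iterS => /(can_inj (@ord_predK n)); apply: IHt.
Qed.

(* A longest path acting nontrivially on [M] generates a standard submodule, and
   a functional detecting its endpoint splits the inclusion. *)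
Lemma brick_stdmod (M : fgmod L) : brick M ->
  exists2 x, x \in U & isomorphic M (stdmod x).
Proof.
case=> [[z1 z1N0] Mend].
pose P t := `[< exists v (z : M), z |> pth v t != 0 >].
have exP : exists t, P t.
  (* The trivial paths sum to 1, so one of them acts nontrivially on [z1]. *)
  exists 0%N; apply/asboolP; apply: contrapT => P0; apply: z1N0.
  rewrite -(act1 z1) -(sum_pth D) act_sumr big1 // => v _.
  by apply/eqP/negPn/negP => zv; apply: P0; exists v, z1.
have pth_act v t (z : M) : z |> pth v t != 0 -> pth v t != 0.
  by apply: contraNneq => ->; rewrite act0.
have boundP t : P t -> (t <= n)%N.
  by move=> /asboolP[v [z /pth_act/pth_neq0[l -> _]]]; apply: ltnW.
case: (ex_maxnP exP boundP) => t0 /asboolP[v [z0 yN0]] maxt.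
have [l t0l xU] := pth_neq0 (pth_act _ _ _ yN0); rewrite {t0}t0l in yN0 maxt.
pose x : carc n := (v, l).
have act_long w t (z : M) : (l < t)%N -> z |> pth w t = 0.
  rewrite ltnNge => /negP lt; apply/eqP/negPn/negP => zt; apply/lt/maxt/asboolP.
  by exists w, z.
have [I [g0 g0P]] := pth_span M.
have [phi [phiD phi_io phi_y]] :=
  @exists_functional k (scaled (io_scaling M)) I g0 g0P _ yN0.
have {}phi_io c (z : M) : phi (z |> io c) = c * phi z by exact: phi_io.
have phi0 : phi 0 = 0 by apply: (addrI (phi 0)); rewrite -phiD !addr0.
(* [G] sends basis vector [s] to [z0] moved along [s] arrows; [H] reads coordinate [s] by following
   the remaining [l - s] arrows and applying [phi]. *)
pose G (z : stdmod x) : M := \sum_(s < l.+1) z0 |> pth v s |> io (coord z s).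
pose H (m : M) : stdmod x := vec x (fun s => phi (m |> pth (down v s) (l - s))).
have GD z z' : G (z + z') = G z + G z'.
  by rewrite -big_split; apply: eq_bigr => s _; rewrite coordD ioD actDr.
have Gio c z : G (z |> io c) = G z |> io c.
  by rewrite act_suml; apply: eq_bigr => s _; rewrite coord_io ioM actM.
have io0 : io 0 = 0 by apply: (addrI (io 0)); rewrite -ioD !addr0.
have Ggen u : G (gen x |> pth v u) = z0 |> pth v u.
  rewrite /G; under eq_bigr do rewrite (coord_gen_pth xU).
  have [ul|ul] := leqP u l; last first.
    rewrite act_long // big1 // => s _; rewrite (_ : _ && _ = false) ?io0 ?act0 //=.
    by have := ltn_ord s; lia.
  rewrite (bigD1 (inord u)) //= inordK // ul eqxx io1 act1 big1 ?addr0 // => s su.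
  case: eqP => [us|_]; last by rewrite andbF io0 act0.
  by case/eqP: su; apply/val_inj; rewrite /= inordK.
have G0 : G 0 = 0 by apply: (addrI (G 0)); rewrite -GD !addr0.
have [g gE] : exists g : {linear stdmod x -> M}, forall z, g z = G z.
  apply: exists_arc_linear => // w t z; rewrite (gen_span xU z) act_suml.
  rewrite !(big_morph G GD G0) act_suml; apply: eq_bigr => s _.
  rewrite -act_pth_io !Gio -act_pth_io Ggen -!(actM _ (pth _ _) (pth _ _)) pthM.
  by congr (_ |> _); case: eqP; rewrite ?Ggen ?act0.
have [h hE] : exists h : {linear M -> stdmod x}, forall m, h m = H m.
  apply: exists_arc_linear => [m m'|c m|w t m]; apply: coord_inj => s.
  - rewrite coordD !coord_vec; case: leqP => _; last by rewrite addr0.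
    by rewrite actDl phiD.
  - rewrite coord_io !coord_vec; case: leqP => _; last by rewrite mul0r.
    by rewrite -act_pth_io phi_io mulrC.
  rewrite coord_pth // !coord_vec -actM pthM /=.
  have [sl|_] := leqP s l; last by rewrite andbF.
  (* For [s < t] the composite path is longer than [l] and acts as zero. *)
  have [ts|ts] /= := leqP t s; last first.
    by case: eqP => _; rewrite ?act0 // act_long // ; lia.
  rewrite (leq_trans (leq_subr t s) sl) -{1}(subnK ts) downD (inj_eq (@down_inj t)).
  by case: eqP => [<-|_]; rewrite ?act0 // ; congr (phi (_ |> pth _ _)); lia.
(* Positions up to [l < n] sit at distinct vertices, so in coordinate [s] only the summand [u = s]
   survives, and there [phi] is 1. *)
have gh z : h (g z) = z.
  rewrite gE hE; apply: coord_inj => s; rewrite coord_vec.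
  have [sl|sl] := leqP s l; last by rewrite coord_out.
  rewrite act_suml (big_morph phi phiD phi0) (bigD1 (inord s)) //= inordK //.
  rewrite big1 => [|u us]; rewrite -act_pth_io phi_io -actM pthM.
    by rewrite eqxx subnKC // phi_y mulr1 addr0.
  case: eqP => [dsu|_]; last by rewrite act0 phi0 mulr0.
  case/eqP: us; apply/val_inj => /=; rewrite inordK //.
  have su : down v s == down v u by rewrite dsu.
  rewrite down_eq ?(leq_ltn_trans sl) // eq_sym in su.
  have : down v u == down v u by [].
  rewrite down_eq; last by have := ltn_ord u; have := ltn_ord l; lia.
  by move/eqP->; apply/eqP.
have gen0 : gen x <> 0.
  move/(congr1 (fun z => coord z 0%N)); rewrite coord_gen coord0 => /eqP.
  by rewrite oner_eq0.
(* This nonzero idempotent is invertible because [M] is a brick, hence it is the identity. *)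
have [|r [rK _]] := Mend (g \o h : {linear M -> M}).
  exists (g (gen x)) => /= e; apply: gen0.
  by rewrite -(gh (gen x)) -(gh (h _)) e linear0.
exists x => //; exists h, g; split=> // m.
by apply: (can_inj rK); rewrite /= gh.
Qed.

(** Taking the classes of the standard modules of its arcs turns a clique into a monobrick,
    bijectively. *)
Lemma has_card_monobrick : has_card (@monobrick L) #|cliques (@fits n) U|.
Proof.
pose cls (A : {set carc n}) (c : fgmod L -> Prop) :=
  exists2 x, x \in A & c = iso_class (stdmod x).
have clsP (A : {set carc n}) x : A \subset U -> x \in U -> cls A (iso_class (stdmod x)) <-> x \in A.
  move=> /subsetP AU xU; split=> [[y yA /iso_classP]|xA]; last by exists x.
  by move/(stdmod_iso_inj xU (AU _ yA))->.
have cliqueU (i : 'I_#|cliques (@fits n) U|) : enum_val i \subset U.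
  by have := enum_valP i; rewrite inE => /andP[].
exists (fun i => cls (enum_val i)); split.
  move=> i j eij; apply/enum_val_inj/setP => x.
  have [xU|xU] := boolP (x \in U); last first.
    by rewrite (contraNF (subsetP (cliqueU i) x) xU) (contraNF (subsetP (cliqueU j) x) xU).
  by apply/idP/idP => /(clsP _ _ (cliqueU _) xU) xc; apply/(clsP _ _ (cliqueU _) xU);
    move: xc; rewrite eij.
move=> C; split=> [[Cb Cm]|[i ->]].
  (* The clique behind [C]; by [brick_stdmod] it accounts for every class in [C]. *)
  pose A := [set x in U | `[< C (iso_class (stdmod x)) >]].
  have AU : A \subset U by apply/subsetP => x; rewrite inE => /andP[].
  have Acl : A \in cliques (@fits n) U.
    rewrite inE AU; apply/is_cliqueP => x y; rewrite !inE.
    move=> /andP[xU /asboolP Cx] /andP[yU /asboolP Cy].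
    apply/negPn/negP => /(stdmod_hom_not_fits xU yU)[f]; apply; exact: Cm.
  exists (enum_rank_in Acl A); rewrite enum_rankK_in //.
  apply/funext => c; apply/propext; split=> [Cc|[x]].
    have [M /brick_stdmod[x xU /iso_classP Mx] cM] := Cb c Cc.
    by exists x; rewrite ?cM // inE xU; apply/asboolP; rewrite -Mx -cM.
  by rewrite inE => /andP[_ /asboolP Cx] ->.
have /subsetP iU := cliqueU i; split=> [c [x /iU xU ->]|M N].
  by exists (stdmod x) => //; apply: stdmod_brick.
(* [M] and [N] are arbitrary members of their classes, so [f] is transported to a map of standard
   modules. *)
move=> [x xi /iso_classP/isomorphic_sym[a [a' [_ aK]]]].
move=> [y yi /iso_classP[b [b' [bK _]]]] f.
have xy : fits x y.
  by have := enum_valP i; rewrite inE => /andP[_ /is_cliqueP]; apply.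
have [f0|finj] := stdmod_hom_fits (b \o f \o a) (iU _ xi) (iU _ yi) xy.
  by left=> z; apply: (can_inj bK); have := f0 (a' z); rewrite /= aK linear0.
by right=> z z' fz; apply: (can_inj aK); apply: finj; rewrite /= !aK fz.
Qed.
End ArcAlgebra.

(** * Path algebras of the linear and the cyclic quiver *)

(** Positions add as lengths do; an entry whose intermediate position leaves the arc is 0 on both
    sides. *)
Lemma path_mxM (k : fieldType) n (x : carc n) v t w r :
  path_mx k x v t *m path_mx k x w r =
  if w == down v t then path_mx k x v (t + r) else 0.
Proof.
apply/matrixP => s u; rewrite mxE.
transitivity (((down x.1 s == v) && (w == down v t) && (u == s + (t + r) :> nat)%N)%:R : k);
  last by case: (w =P _) => _; rewrite !mxE ?andbT ?andbF.
have [st|st] := leqP (s + t) x.2; last first.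
  rewrite big1 => [|q _].
    by rewrite (_ : (u == _ :> nat) = false) ?andbF //; have := ltn_ord u; lia.
  by rewrite !mxE (_ : (q == _ :> nat) = false) ?andbF ?mul0r //; have := ltn_ord q; lia.
rewrite (bigD1 (inord (s + t))) //= big1 ?addr0 => [|q qst].
  rewrite !mxE inordK // eqxx andbT -natrM mulnb downD addnA [w == _]eq_sym.
  by case: (down x.1 s =P v) => // ->.
rewrite !mxE; case: (q =P _ :> nat) => [e|_]; last by rewrite andbF mul0r.
by case/eqP: qst; apply/val_inj; rewrite /= inordK // ltnS.
Qed.

Lemma sum_path_mx0 (k : fieldType) n (x : carc n) : \sum_v path_mx k x v 0 = 1%:M.
Proof.
apply/matrixP => s u; rewrite summxE (bigD1 (down x.1 s)) //= big1 => [|v vs].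
  by rewrite !mxE eqxx addr0 addn0 eq_sym.
by rewrite mxE eq_sym (negPf vs).
Qed.

(** * Quivers with at most one arrow out of each vertex, leading to its predecessor *)

Section DownQuiver.
Variables (k : fieldType) (n : nat) (E : finType) (s t : E -> 'I_n).
Hypothesis s_inj : injective s.
Hypothesis tE : forall a, t a = ord_pred (s a).
Local Notation Q := (Quiver s t).
Local Notation A := (path_alg k Q).
Implicit Types (p q : qpath Q) (v w : 'I_n).

Lemma walk_end_down v a : @walk Q v a -> walk_end (Q := Q) v a = down v (size a).
Proof.
elim: a v => // e a IHa v /= /andP[/eqP ev wa].
by rewrite -[LHS]/(walk_end (Q := Q) (t e) a) (IHa _ wa) tE ev -[RHS]/(iter (size a).+1 _ v) iterSr.
Qed.

Lemma walk_inj v a b : @walk Q v a -> @walk Q v b -> size a = size b -> a = b.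
Proof.
elim: a b v => [|e a IHa] [|e' b] v //= /andP[/eqP ev wa] /andP[/eqP e'v wb] [sab].
have ee' : e = e' by apply: s_inj; rewrite ev e'v.
by rewrite -ee' (IHa b (t e)) // ee'.
Qed.

Lemma path_tgt_down p : path_tgt p = down (path_src p) (path_length p).
Proof. exact: walk_end_down (valP p). Qed.

Lemma qpath_inj p q : path_src p = path_src q -> path_length p = path_length q -> p = q.
Proof.
case: p q => [[v a] wa] [[w b] wb].
rewrite /path_src /path_length /path_arrows /= => vw ab; apply: val_inj => /=.
by rewrite vw (walk_inj (v := w) (a := a) _ wb ab) // -vw.
Qed.

Definition has_path v m := exists p : qpath Q, path_src p = v /\ path_length p = m.

Lemma has_path0 v : has_path v 0.
Proof. by exists (trivial_path (Q := Q) v). Qed.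

Lemma has_pathS v e m : s e = v -> has_path (ord_pred v) m -> has_path v m.+1.
Proof.
move=> ev [p [pv pm]]; have w : @walk Q v (e :: path_arrows p).
  by rewrite /= ev eqxx /= tE ev -pv; apply: (valP p).
by exists (exist _ (v, e :: path_arrows p) w); split=> //; rewrite -pm.
Qed.

Lemma has_pathD v m r : has_path v (m + r) <-> has_path v m /\ has_path (down v m) r.
Proof.
split=> [[p [pv pm]]|[[p [pv pm]] [q [qv qr]]]]; last first.
  have pq : path_tgt p = path_src q by rewrite path_tgt_down pv pm qv.
  exists (path_cat p q); rewrite path_cat_src // pv; split=> //.
  by rewrite /path_length /path_arrows path_catK //= size_cat -/(path_length p) pm -qr.
have := valP p; rewrite -/(path_src p) -/(path_arrows p) -(cat_take_drop m (path_arrows p)).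
rewrite walk_cat => /andP[w1 w2]; have sz : size (take m (path_arrows p)) = m.
  by rewrite size_takel // -/(path_length p) pm leq_addr.
rewrite (walk_end_down w1) sz pv in w2; rewrite pv in w1; split.
  by exists (exist _ (v, take m (path_arrows p)) w1).
exists (exist _ (down v m, drop m (path_arrows p)) w2); split=> //.
by rewrite [LHS]size_drop -/(path_length p) pm addKn.
Qed.

(** By [qpath_inj] such a path is unique, so the choice made by [cid] is harmless. *)
Definition path_from v m : A :=
  if pselect (has_path v m) is left h then path_vec k (projT1 (cid h)) else 0.

Lemma path_fromE p : path_from (path_src p) (path_length p) = path_vec k p.
Proof.
rewrite /path_from; case: pselect => [h|[]]; last by exists p.
by congr path_vec; case: cid => q /= [??]; apply: qpath_inj.
Qed.

Lemma path_from0 v m : ~ has_path v m -> path_from v m = 0.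
Proof. by rewrite /path_from; case: pselect. Qed.

Lemma path_fromM v m w r : path_from v m * path_from w r =
  if w == down v m then path_from v (m + r) else 0.
Proof.
have [[p [<- <-]]|nvm] := pselect (has_path v m); last first.
  rewrite (path_from0 nvm) mul0r; case: eqP => // _.
  by rewrite path_from0 // => /has_pathD[].
have [[q [<- <-]]|nwr] := pselect (has_path w r); last first.
  rewrite (path_from0 nwr) mulr0; case: eqP => // e.
  by rewrite path_from0 // => /has_pathD[_]; rewrite -e.
rewrite !path_fromE -[LHS]/(palg_mul _ _) palg_mulUU.
case: eqP => [pq|/eqP pq]; last by rewrite path_mul0 // path_tgt_down eq_sym.
rewrite -path_tgt_down in pq; rewrite path_mul_cat // -path_fromE path_cat_src //.
by rewrite {1}/path_length /path_arrows path_catK //= size_cat.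
Qed.

Lemma sum_path_from : \sum_v path_from v 0 = 1.
Proof.
rewrite -[RHS]/(palg_one k Q); apply: eq_bigr => v _.
by rewrite -(path_fromE (trivial_path (Q := Q) v)).
Qed.

Lemma palg_ind (P : A -> Prop) : P 0 -> (forall a b, P a -> P b -> P (a + b)) ->
  (forall c p, P (c *: path_vec k p)) -> forall a, P a.
Proof. by move=> P0 PD PZ a; rewrite (palgE a); apply: big_ind. Qed.

Section PathRep.
Variable x : carc n.

Definition path_rep_fun (a : A) : 'M[k]_(x.2.+1) :=
  \sum_(p <- msupp a) a@_p *: path_mx k x (path_src p) (path_length p).

Lemma path_rep_funw (d : {fset qpath Q}) (a : A) : (msupp a `<=` d)%fset ->
  path_rep_fun a = \sum_(p <- d) a@_p *: path_mx k x (path_src p) (path_length p).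
Proof.
move=> le_d; rewrite /path_rep_fun (big_fset_incl _ le_d) //= => p _ /mcoeff_outdom ->.
by rewrite scale0r.
Qed.

Lemma path_rep_funD a b : path_rep_fun (a + b) = path_rep_fun a + path_rep_fun b.
Proof.
rewrite (path_rep_funw (msuppD_le a b)) (path_rep_funw (fsubsetUl (msupp a) (msupp b))).
rewrite (path_rep_funw (fsubsetUr (msupp a) (msupp b))) -big_split /=.
by apply: eq_bigr => p _; rewrite mcoeffD scalerDl.
Qed.

Lemma path_rep_funZ c a : path_rep_fun (c *: a) = c *: path_rep_fun a.
Proof.
rewrite (path_rep_funw (msuppZ_le c a)) /path_rep_fun scaler_sumr.
by apply: eq_bigr => p _; rewrite mcoeffZ scalerA.
Qed.

Lemma path_rep_vec p :
  path_rep_fun (path_vec k p) = path_mx k x (path_src p) (path_length p).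
Proof.
rewrite (path_rep_funw (d := [fset p]%fset)) ?path_vec.unlock ?msuppU_le //.
by rewrite big_seq_fset1 mcoeffUU scale1r.
Qed.

Lemma path_rep_fun0 : path_rep_fun 0 = 0.
Proof. by rewrite -(scale0r (0 : A)) path_rep_funZ scale0r. Qed.

Lemma path_rep_funMZ c d a b : path_rep_fun (a * b) = path_rep_fun a *m path_rep_fun b ->
  path_rep_fun ((c *: a) * (d *: b)) = path_rep_fun (c *: a) *m path_rep_fun (d *: b).
Proof.
move=> ab; have -> : (c *: a) * (d *: b) = c *: (d *: (a * b)).
  by rewrite -(palg_scalerAl c a (d *: b)) -(palg_scalerAr d a b).
(* Rewriting would try to unify [a] with [c *: a] by unfolding the latter. *)
refine (etrans (path_rep_funZ c (d *: (a * b))) _).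
refine (etrans (congr1 (fun M => c *: M) (path_rep_funZ d (a * b))) _).
refine (esym (etrans (congr2 (@mulmx k _ _ _) (path_rep_funZ c a) (path_rep_funZ d b)) _)).
by rewrite -scalemxAl -scalemxAr ab.
Qed.

Lemma path_rep_funM a b : path_rep_fun (a * b) = path_rep_fun a *m path_rep_fun b.
Proof.
move: a; apply: palg_ind => [|a a' ha ha'|c p].
- by rewrite mul0r path_rep_fun0 mul0mx.
- by rewrite mulrDl !path_rep_funD ha ha' mulmxDl.
move: b; apply: palg_ind => [|b b' hb hb'|d q].
- by rewrite mulr0 path_rep_fun0 mulmx0.
- by rewrite mulrDr !path_rep_funD hb hb' mulmxDr.
apply: path_rep_funMZ.
rewrite (path_rep_vec p) (path_rep_vec q) path_mxM -(path_fromE p) -(path_fromE q).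
rewrite path_fromM.
case: eqP => [e|_]; last by rewrite path_rep_fun0.
have [r [<- <-]] : has_path (path_src p) (path_length p + path_length q).
  by apply/has_pathD; split; [exists p | exists q].
by rewrite path_fromE path_rep_vec.
Qed.

Lemma path_rep_fun1 : path_rep_fun 1 = 1%:M.
Proof.
rewrite -sum_path_from -sum_path_mx0.
rewrite (big_morph _ path_rep_funD path_rep_fun0); apply: eq_bigr => v _.
have [p [<- <-]] := has_path0 v; by rewrite path_fromE path_rep_vec.
Qed.
End PathRep.

Section Quotient.
Variables (L : pzRingType) (pi : A -> L) (U : {set carc n}).
Variable rp : forall x : carc n, L -> 'M[k]_(x.2.+1).
Hypothesis piD : forall a b, pi (a + b) = pi a + pi b.
Hypothesis piM : forall a b, pi (a * b) = pi a * pi b.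
Hypothesis pi1 : pi 1 = 1.
Hypothesis pi_onto : forall a, exists b, pi b = a.
Hypothesis rp_pi : forall x a, rp x (pi a) = path_rep_fun x a.
Hypothesis pi_neq0 : forall v m, pi (path_from v m) != 0 ->
  exists2 l : 'I_n, m = l & (v, l) \in U.
Hypothesis no_path : forall x v m, x \in U -> ~ has_path v m -> path_mx k x v m = 0.

Definition quotient_rep (x : carc n) : matrep k L x.2.+1.
Proof.
exists (rp x).
- move=> a b; have [[a' <-] [b' <-]] := (pi_onto a, pi_onto b).
  by rewrite -piD !rp_pi path_rep_funD.
- move=> a b; have [[a' <-] [b' <-]] := (pi_onto a, pi_onto b).
  by rewrite -piM !rp_pi path_rep_funM.
- by rewrite -pi1 rp_pi path_rep_fun1.
Defined.

(** Serves both algebras: [pi] is the identity for [A_alg] and the quotient projection for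
    [B_alg]. *)
Definition quotient_arc_algebra : arc_algebra k L U.
Proof.
have pi0 : pi 0 = 0 by apply: (addrI (pi 0)); rewrite -piD !addr0.
refine (@ArcAlgebra k n L U (fun c => pi (c *: (1 : A))) (fun v m => pi (path_from v m))
  quotient_rep _ _ _ _ _ _ _ _ _ _).
- by move=> a b; rewrite scalerDl piD.
- by move=> a b; rewrite -piM -palg_scalerAl mul1r scalerA.
- by rewrite scale1r pi1.
- by move=> c v m; rewrite -!piM -palg_scalerAl -palg_scalerAr mul1r mulr1.
- by move=> v m w r; rewrite -piM path_fromM; case: eqP.
- by rewrite -(big_morph _ piD pi0) sum_path_from pi1.
- exact: pi_neq0.
- move=> P P0 PD PZ a; have [b <-] := pi_onto a; move: b.
  apply: palg_ind => [|a' b ha hb|c p]; first by rewrite pi0.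
    by rewrite piD; apply: PD.
  by rewrite -path_fromE -[path_from _ _]mul1r palg_scalerAl piM.
- by move=> x c; rewrite /= rp_pi path_rep_funZ path_rep_fun1 scalemx1.
move=> x v m xU /=; rewrite rp_pi.
have [[p [<- <-]]|nvm] := pselect (has_path v m); first by rewrite path_fromE path_rep_vec.
by rewrite path_from0 // path_rep_fun0 no_path.
Defined.
End Quotient.
End DownQuiver.

(** * The linear quiver: arcs that do not wrap around *)

Section LinearQuiver.
Variables (k : fieldType) (n : nat).
Local Notation E := {i : 'I_n | (0 < i)%N}.
Local Notation lsrc := (val : E -> 'I_n).
Local Notation ltgt := (fun i : E => ord_pred (val i)).

Lemma linear_has_path v m : has_path lsrc ltgt v m <-> (m <= v)%N.
Proof.
have v_lt := ltn_ord v.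
elim: m v v_lt => [|m IHm] v vn; first by split=> // _; apply: has_path0.
have pred_v : (0 < v)%N -> ord_pred v = v.-1 :> nat.
  by move=> v0; have := val_down v (leq_trans v0 (ltnW vn)); rewrite v0 subn1.
split=> [|mv].
  (* Cuts off the first arrow, whose existence forces [v] to be positive. *)
  rewrite -addn1 addnC => /(proj1 (@has_pathD n E lsrc ltgt (fun=> erefl) v 1 m)) [[[[w a] wa]]].
  rewrite /path_src /path_length /path_arrows /= => -[wv a1] /(IHm _ (ltn_ord _)) mv.
  case: a wa a1 => // e [|//] /=; rewrite andbT => /eqP ew _.
  have v0 : (0 < v)%N by rewrite -wv -ew; apply: (valP e).
  by have : (m <= ord_pred v)%N := mv; rewrite (pred_v v0); lia.
have v0 : (0 < v)%N by apply: leq_trans mv.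
apply: (@has_pathS n E lsrc ltgt (fun=> erefl) v (exist _ v v0)) => //.
by apply/IHm => //; rewrite pred_v //; lia.
Qed.

Definition linear_arc_algebra : arc_algebra k (A_alg k n) [set x : carc n | (x.2 <= x.1)%N].
Proof.
apply: (@quotient_arc_algebra k n E lsrc ltgt val_inj (fun=> erefl)
  (path_alg k (Quiver lsrc ltgt)) id _
  (fun x a => path_rep_fun x a)) => //.
- by move=> a; exists a.
- move=> v m; case: (leqP m v) => [mv _|vm]; last first.
    by rewrite path_from0 ?eqxx // => /linear_has_path; rewrite leqNgt vm.
  by exists (Ordinal (leq_ltn_trans mv (ltn_ord v))); rewrite ?inE.
move=> x v m; rewrite inE => xU; move/linear_has_path/negP; rewrite -ltnNge => vm.
(* A nonzero entry would give [v = x.1 - s] and [s + m <= x.2 <= x.1], against [v < m]. *)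
apply/matrixP => s u; rewrite !mxE; case: eqP => //= dv; case: eqP => // us.
have := val_down x.1 (ltnW (leq_trans (ltn_ord s) (ltn_ord x.2))); rewrite dv.
have smx : (s + m <= x.1)%N by rewrite (leq_trans _ xU) // -us -ltnS.
by rewrite (leq_trans (leq_addr m s) smx) => vE; move: vm; rewrite vE; lia.
Defined.
End LinearQuiver.

(** * The cyclic quiver modulo paths of length [n]: all arcs *)

Section CyclicQuiver.
Local Open Scope quotient_scope.
Variables (k : fieldType) (n : nat).
Local Notation csrc := (@id 'I_n).
Local Notation ctgt := (@ord_pred n).
Local Notation Q := (Quiver csrc ctgt).
Local Notation S := (@path_of_length k Q n).
Local Notation from := (path_from k csrc ctgt).

Lemma cyclic_has_path v m : has_path csrc ctgt v m.
Proof.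
by elim: m v => [|m IHm] v; [apply: has_path0|apply: (@has_pathS n _ csrc ctgt (fun=> erefl) v v)].
Qed.

(** Such a path begins with one of length [n], a generator of the ideal. *)
Lemma path_from_long v m : (n <= m)%N -> from v m \in ideal_gen S.
Proof.
move=> nm; have [p [pv pn]] := cyclic_has_path v n.
have -> : from v m = from v n * from (down v n) (m - n).
  by rewrite (path_fromM k (@inj_id _) (fun=> erefl)) eqxx subnKC.
apply: ideal_genMr; apply/asboolP => I _; apply; exists p => //.
by have := path_fromE k (@inj_id _) p; rewrite pv pn.
Qed.

(** An arc has at most [n] vertices, so a shift by [n] leaves it and the generators act as zero. *)
Lemma path_rep_ideal x (a : path_alg k Q) : a \in ideal_gen S -> path_rep_fun x a = 0.
Proof.
move=> /asboolP/(_ (fun a => path_rep_fun x a = 0)); apply.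
  split=> [|b c b0 c0|b c c0].
  - exact: path_rep_fun0.
  - have := path_rep_funD x (b - c) c.
    by rewrite subrK b0 c0 addr0.
  - by split; rewrite (path_rep_funM (@inj_id _) (fun=> erefl)) c0 ?mulmx0 ?mul0mx.
move=> _ [p pn ->]; rewrite path_rep_vec pn; apply/matrixP => s u; rewrite !mxE.
by rewrite (_ : (u == _ :> nat) = false) ?andbF //; have := ltn_ord u; have := ltn_ord x.2; lia.
Qed.

(** Matrices are evaluated at a representative; [path_rep_ideal] makes the choice immaterial. *)
Definition cyclic_arc_algebra : arc_algebra k (B_alg k n) [set: carc n].
Proof.
apply: (@quotient_arc_algebra k n _ csrc ctgt (@inj_id _) (fun=> erefl)
  (quot_ring S) (fun a => \pi_(quot_ring S) a) _
  (fun x a => path_rep_fun x (repr a))).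
- exact: quot_piD.
- by move=> a b; rewrite -quot_piM.
- by [].
- by move=> a; exists (repr a); rewrite reprK.
- move=> x a; have /(path_rep_ideal x) := quot_repr S a.
  have := path_rep_funD x (repr (\pi_(quot_ring S) a) - a) a.
  by rewrite subrK => -> ->; rewrite add0r.
- move=> v m vm; have mn : (m < n)%N.
    rewrite ltnNge; apply: contra vm => /(path_from_long v) vm.
    rewrite -(_ : \pi_(quot_ring S) 0 = 0) ?quot_eqE ?subr0 //.
    by apply: (addrI (\pi_(quot_ring S) 0)); rewrite -quot_piD !addr0.
  by exists (Ordinal mn); rewrite ?inE.
by move=> x v m _ []; apply: cyclic_has_path.
Defined.
End CyclicQuiver.

Theorem theorem6p12 (k : closedFieldType) (n : nat) (hn : (0 < n)%N) :
  [/\ has_card (@monobrick (A_alg k n)) (large_schroeder n),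
      (large_schroeder n)%:R =
        \sum_(i < n.+1) (i.+1)%:R^-1 * ('C(n, i))%:R * ('C(n + i, i))%:R :> rat
    & has_card (@monobrick (B_alg k n))
        (2 * \sum_(i < n) 'C(n.-1, i) * 'C(n + i, i))%N].
Proof.
rewrite large_schroederE; split.
- rewrite -(card_linear_cliques hn); exact: has_card_monobrick (linear_arc_algebra k n).
- exact: schr_formula.
- rewrite -(cyclic_cliques_formula hn); exact: has_card_monobrick (cyclic_arc_algebra k n).
Qed.
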